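(* Let $G$ be a smooth function, let $m_G$ be defined implicitly by $x=\pi\int_{\sqrt{m_G(x)}}^{+\infty}\eta(it/2)^4G(R(e^{-\pi t}))dt$, and put $y(A)=R\!\left(e^{-\pi\sqrt{m_G(A)}}\right)$. Regarding $A$ as a function of $k_{m_G}:=k_{m_G(A)}$, one has $$\frac{dA}{dk_{m_G}}=\sqrt[3]{2}\,\frac{G\left(y(A)\right)}{\left(k_{m_G}k'_{m_G}\right)^{2/3}} .$$
   Context: $\eta(\tau)=e^{\pi i\tau/12}\prod_{n\ge1}(1-e^{2\pi i n\tau})$ is the Dedekind eta function; $R(q)=\cfrac{q^{1/5}}{1+\cfrac{q}{1+\cfrac{q^2}{1+\cdots}}}$ ($0<q<1$) is the Rogers–Ramanujan continued fraction. For $r>0$, the elliptic singular modulus $k_r\in(0,1)$ is defined by $K\!\left(\sqrt{1-k_r^2}\right)/K(k_r)=\sqrt r$, where $K(k)=\int_0^{\pi/2}\frac{d\theta}{\sqrt{1-k^2\sin^2\theta}}$, and $k'_r=\sqrt{1-k_r^2}$. *)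

(* Defs.v *)
From Stdlib Require Import Reals.
From Coquelicot Require Import Coquelicot.
Open Scope R_scope.

Definition ellK (k : R) : R :=
  RInt (fun th => / sqrt (1 - k ^ 2 * (sin th) ^ 2)) 0 (PI / 2).

Definition kcomp (k : R) : R := sqrt (1 - k ^ 2).

(* The singular modulus k_r is defined by K(k'_r)/K(k_r) = sqrt r.
   Hence the parameter r with k_r = k is r = (K(k')/K(k))^2. *)
Definition is_singular_modulus (r k : R) : Prop :=
  0 < k < 1 /\ ellK (kcomp k) / ellK k = sqrt r.
Definition sing_param (k : R) : R := (ellK (kcomp k) / ellK k) ^ 2.

Fixpoint qprod (x : R) (N : nat) : R :=
  match N with
  | O => 1
  | S N' => qprod x N' * (1 - x ^ N)
  end.

(* Dedekind eta on the positive imaginary axis: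
   eta_imag y = eta(i y) = e^{-pi y/12} prod_{n>=1} (1 - e^{-2 pi n y}),  y > 0. *)
Definition eta_imag (y : R) : R :=
  exp (- PI * y / 12) * real (Lim_seq (fun N => qprod (exp (- 2 * PI * y)) N)).

Fixpoint cf_tail (q : R) (n j : nat) : R :=
  match n with
  | O => 1
  | S n' => 1 + q ^ j / cf_tail q n' (S j)
  end.

(* Rogers-Ramanujan continued fraction, 0 < q < 1:
   R(q) = q^{1/5} / (1 + q/(1 + q^2/(1 + ...))). *)
Definition RR (q : R) : R :=
  Rpower q (1 / 5) / real (Lim_seq (fun N => cf_tail q N 1)).

Definition smooth (G : R -> R) : Prop := forall (n : nat) (x : R), ex_derive_n G n x.

Definition A_of_m (G : R -> R) (m : R) : R :=
  PI * RInt_gen (fun t => (eta_imag (t / 2)) ^ 4 * G (RR (exp (- PI * t))))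
         (at_point (sqrt m)) (Rbar_locally p_infty).

(* A regarded as a function of k = k_{m_G(A)}: m_G(A) = sing_param k. *)
Definition A_of_k (G : R -> R) (k : R) : R := A_of_m G (sing_param k).

(* Main.v *)
Require Import Defs.
From Stdlib Require Import Reals Lra Lia Psatz.
From Coquelicot Require Import Coquelicot.
Open Scope R_scope.

(* By the fundamental theorem of calculus dA/dk = - pi eta(i s/2)^4 G(R(e^(- pi s))) s'(k) with
   s = K(k')/K(k).  Legendre's relation gives s'(k) = - pi / (2 k k'^2 K^2), and it remains to see
   that 16 eta(i s/2)^24 = (2K/pi)^12 k'^8 k^2.

   Let q = e^(- pi s), a = theta_3(q)^2, b = theta_4(q)^2.  The triple product at z = 1 and z = -1
   shows that q -> q^2 replaces (a, b) by ((a + b)/2, sqrt(ab)).  Gauss's integral of (a, b) is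
   invariant under this step and the ratio K'/K of the modulus with k' = b/a is doubled by it.  As
   (a, b) -> (1, 1) for q -> 0, one gets K = pi a/2, and comparing K'/K with -(2/pi) ln k near
   k = 0 gives K'/K = - ln q / pi; since s is injective the modulus with k' = b/a is k.  The same
   iteration shows 16 q prod (1 - q^n)^24 = a^2 b^8 (a^2 - b^2): the quotient V of the two sides
   satisfies V(q)^2 = V(q^2) and stays between positive bounds near q = 0. *)

(** * The arithmetic-geometric mean and the Landen transformation *)

(** The theta identities are proved by descent along q -> q^2, without any inversion formula: a
    discrepancy that picks up a fixed factor under squaring of q and is controlled near q = 0
    vanishes on all of (0, 1). If it doubles, boundedness near 0 is enough, so crude constants
    suffice for K'/K and for ln V. If u(q) = s u(q^2) with |s| <= 2, decay of order q is required.
    The arithmetic mean relation is itself of this second kind: the product gives theta_3(q)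
    theta_4(q) = theta_4(q^2)^2, the series gives theta_3(q) + theta_4(q) = 2 theta_3(q^4), and
    together they only yield u(q) = -2 u(q^2) for the defect u. The integrand contains eta^4 while
    the modulus determines eta^24, so the last identity is compared through sixth powers of positive
    numbers. The improper integral is a limit, hence its convergence must be established before
    differentiating: G is bounded on [0, 1], where R takes its values, and eta^4 decays
    exponentially. *)

Lemma cos2_sin2 (t : R) : cos t ^ 2 = 1 - sin t ^ 2.
Proof. generalize (sin2_cos2 t); unfold Rsqr; intros; nra. Qed.

Ltac eqR := match goal with |- ?x = ?y => change (@eq R x y) end.

Lemma scal_mult (x y : R) : scal x y = x * y.
Proof. reflexivity. Qed.

Lemma opp_R (x : R) : opp x = - x.
Proof. reflexivity. Qed.

Lemma continuous_of_derivable (f : R -> R) (x : R) : ex_derive f x -> continuous f x.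
Proof. exact (ex_derive_continuous f x). Qed.

Definition gauss_int (a b : R) : R :=
  RInt (fun t => / sqrt (a ^ 2 * cos t ^ 2 + b ^ 2 * sin t ^ 2)) 0 (PI / 2).

Lemma gauss_form_pos (a b t : R) : 0 < a -> 0 < b ->
  0 < a ^ 2 * cos t ^ 2 + b ^ 2 * sin t ^ 2.
Proof.
intros ha hb.
assert (h : 0 <= sin t ^ 2 <= 1).
{ split; [apply pow2_ge_0|]. generalize (cos2_sin2 t) (pow2_ge_0 (cos t)); lra. }
rewrite cos2_sin2.
assert (0 < a ^ 2) by (apply pow_lt; lra).
assert (0 < b ^ 2) by (apply pow_lt; lra).
destruct (Rle_or_lt (sin t ^ 2) (1 / 2)).
- apply Rplus_lt_le_0_compat; [apply Rmult_lt_0_compat | apply Rmult_le_pos]; lra.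
- apply Rplus_le_lt_0_compat; [apply Rmult_le_pos | apply Rmult_lt_0_compat]; lra.
Qed.

Lemma gauss_continuous (a b t : R) : 0 < a -> 0 < b ->
  continuous (fun t => / sqrt (a ^ 2 * cos t ^ 2 + b ^ 2 * sin t ^ 2)) t.
Proof.
intros ha hb; apply continuous_of_derivable; auto_derive.
generalize (gauss_form_pos a b t ha hb); intro h.
split; [exact h | split; [apply Rgt_not_eq, sqrt_lt_R0, h | exact I]].
Qed.

Lemma gauss_ex_RInt (a b u v : R) : 0 < a -> 0 < b ->
  ex_RInt (fun t => / sqrt (a ^ 2 * cos t ^ 2 + b ^ 2 * sin t ^ 2)) u v.
Proof.
intros ha hb; apply (ex_RInt_continuous (V := R_CompleteNormedModule)).
intros; now apply gauss_continuous.
Qed.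

Lemma gauss_int_scale (c a b : R) : 0 < c -> 0 < a -> 0 < b ->
  gauss_int (c * a) (c * b) = gauss_int a b / c.
Proof.
intros hc ha hb; unfold gauss_int.
rewrite (RInt_ext _ (fun t => scal (/ c) (/ sqrt (a ^ 2 * cos t ^ 2 + b ^ 2 * sin t ^ 2)))).
- rewrite (RInt_scal (V := R_CompleteNormedModule)).
  + rewrite ?scal_mult. unfold Rdiv; apply Rmult_comm.
  + now apply gauss_ex_RInt.
- intros t _. rewrite ?scal_mult.
  rewrite <- Rinv_mult; f_equal.
  replace ((c * a) ^ 2 * cos t ^ 2 + (c * b) ^ 2 * sin t ^ 2)
    with (c ^ 2 * (a ^ 2 * cos t ^ 2 + b ^ 2 * sin t ^ 2)) by ring.
  rewrite sqrt_mult_alt by apply pow2_ge_0. rewrite sqrt_pow2 by lra. reflexivity.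
Qed.

(** The form is invariant under t -> PI - t. The doubled range is the one onto which Landen's
    substitution maps. *)
Lemma gauss_int_half (a b : R) : 0 < a -> 0 < b ->
  RInt (fun t => / sqrt (a ^ 2 * cos t ^ 2 + b ^ 2 * sin t ^ 2)) 0 PI = 2 * gauss_int a b.
Proof.
intros ha hb.
rewrite <- (RInt_Chasles (V := R_CompleteNormedModule) _ 0 (PI / 2) PI) by now apply gauss_ex_RInt.
unfold gauss_int.
set (f := fun t => / sqrt (a ^ 2 * cos t ^ 2 + b ^ 2 * sin t ^ 2)).
enough (e : RInt f (PI / 2) PI = RInt f 0 (PI / 2)).
{ rewrite e. change (RInt f 0 (PI / 2) + RInt f 0 (PI / 2) = 2 * RInt f 0 (PI / 2)). ring. }
assert (h := RInt_comp_lin (V := R_CompleteNormedModule) f (-1) PI 0 (PI / 2)).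
replace (-1 * 0 + PI) with PI in h by ring.
replace (-1 * (PI / 2) + PI) with (PI / 2) in h by field.
rewrite <- (opp_RInt_swap (V := R_CompleteNormedModule)) by (now apply gauss_ex_RInt).
rewrite <- h by (now apply gauss_ex_RInt).
rewrite (RInt_ext _ (fun t => opp (f t))).
- rewrite (RInt_opp (V := R_CompleteNormedModule)) by (now apply gauss_ex_RInt).
  now rewrite opp_opp.
- intros t _. rewrite ?scal_mult, ?opp_R.
  unfold f. replace (-1 * t + PI) with (PI - t) by ring.
  rewrite sin_PI_x.
  replace (cos (PI - t)) with (- cos t).
  2:{ rewrite cos_minus, cos_PI, sin_PI; ring. }
  replace ((- cos t) ^ 2) with (cos t ^ 2) by ring. eqR; ring.
Qed.

(* Landen's substitution [phi |-> phi + atan (b / a * tan phi)] from [0, PI/2] onto [0, PI],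
   written so that it is smooth at [PI/2]. *)
Definition landen (a b t : R) : R :=
  2 * t - atan ((a - b) * sin t * cos t / (a * cos t ^ 2 + b * sin t ^ 2)).

Section Landen.
Variables a b : R.
Hypotheses (ha : 0 < a) (hb : 0 < b).

Lemma landen_den_pos (t : R) : 0 < a * cos t ^ 2 + b * sin t ^ 2.
Proof.
generalize (gauss_form_pos (sqrt a) (sqrt b) t (sqrt_lt_R0 _ ha) (sqrt_lt_R0 _ hb)).
rewrite !pow2_sqrt by lra. auto.
Qed.

(** With X the denominator and Y the numerator inside [landen], X + i Y = (cos t + i sin t)(a cos t
    - i b sin t), and the right side has squared modulus a^2 cos^2 t + b^2 sin^2 t. *)
Lemma landen_rho (t : R) :
  (a * cos t ^ 2 + b * sin t ^ 2) ^ 2 + ((a - b) * sin t * cos t) ^ 2 =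
  a ^ 2 * cos t ^ 2 + b ^ 2 * sin t ^ 2.
Proof.
generalize (cos2_sin2 t); intro h.
replace (((a - b) * sin t * cos t) ^ 2) with ((a - b) ^ 2 * sin t ^ 2 * cos t ^ 2) by ring.
rewrite h; ring.
Qed.

Lemma landen_derive (t : R) :
  is_derive (landen a b) t (1 + a * b / (a ^ 2 * cos t ^ 2 + b ^ 2 * sin t ^ 2)).
Proof.
generalize (landen_den_pos t) (landen_rho t) (gauss_form_pos a b t ha hb); intros hX hr hp.
unfold landen; auto_derive; [lra|].
set (X := a * cos t ^ 2 + b * sin t ^ 2) in *.
rewrite <- hr.
assert (hr' : X ^ 2 + ((a - b) * sin t * cos t) ^ 2 <> 0) by lra.
fold X.
(* The quotient is (Y' X - Y X') / (X^2 + Y^2), the derivative of atan (Y / X), with X' = - 2 Y. *)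
match goal with |- ?L = _ => replace L with
 (2 - ((a - b) * (cos t ^ 2 - sin t ^ 2) * X + 2 * ((a - b) * sin t * cos t) ^ 2) /
     (X ^ 2 + ((a - b) * sin t * cos t) ^ 2)) end.
2:{ unfold X, Rsqr; field. split.
  - intro h; apply (Rgt_not_eq _ _ hX); unfold X; rewrite <- h; ring.
  - intro h; apply hr'; unfold X; rewrite <- h; ring. }
rewrite hr. unfold X.
replace (((a - b) * sin t * cos t) ^ 2) with ((a - b) ^ 2 * sin t ^ 2 * cos t ^ 2) by ring.
rewrite cos2_sin2 in *. field. lra.
Qed.

(** [landen a b t] is an argument of (cos t + i sin t)(a cos t + i b sin t), a number of modulus r;
    these are its real and imaginary parts divided by r. *)
Lemma landen_cos_sin (t : R) :
  let r := sqrt (a ^ 2 * cos t ^ 2 + b ^ 2 * sin t ^ 2) in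
  cos (landen a b t) = (a * cos t ^ 2 - b * sin t ^ 2) / r /\
  sin (landen a b t) = (a + b) * sin t * cos t / r.
Proof.
intro r.
generalize (landen_den_pos t) (landen_rho t) (gauss_form_pos a b t ha hb); intros hX hr hp.
set (X := a * cos t ^ 2 + b * sin t ^ 2) in *.
assert (hr0 : 0 < r) by (apply sqrt_lt_R0, hp).
assert (hs : sqrt (1 + Rsqr ((a - b) * sin t * cos t / X)) = r / X).
{ unfold r. rewrite <- hr.
  replace (1 + Rsqr ((a - b) * sin t * cos t / X))
    with ((X ^ 2 + ((a - b) * sin t * cos t) ^ 2) / X ^ 2) by (unfold Rsqr; field; lra).
  rewrite sqrt_div_alt by (apply pow_lt; lra).
  now rewrite sqrt_pow2 by lra. }
unfold landen; fold X.
rewrite cos_minus, sin_minus, cos_atan, sin_atan, hs, cos_2a, sin_2a.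
unfold X. split; field_simplify_eq; try (fold X; lra).
- replace (cos t ^ 4) with (cos t ^ 2 * cos t ^ 2) by ring.
  replace (cos t ^ 3) with (cos t ^ 2 * cos t) by ring.
  rewrite cos2_sin2; ring.
- replace (cos t ^ 3) with (cos t ^ 2 * cos t) by ring.
  replace (cos t ^ 5) with (cos t ^ 2 * cos t ^ 2 * cos t) by ring.
  rewrite cos2_sin2; ring.
Qed.

(** Substitute [landen] in the integral of the new form over [0, PI]. The Jacobian is (r^2 + a b) /
    r^2 = (a + b) X / r^2 and the root of the new form is (a + b) X / (2 r), so the quotient is 2 /
    r, twice the old integrand. *)
Lemma gauss_int_agm : gauss_int a b = gauss_int ((a + b) / 2) (sqrt (a * b)).
Proof.
assert (hab : 0 < a * b) by (apply Rmult_lt_0_compat; lra).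
assert (hs : 0 < sqrt (a * b)) by (apply sqrt_lt_R0, hab).
assert (h := RInt_comp (V := R_CompleteNormedModule)
  (fun t => / sqrt (((a + b) / 2) ^ 2 * cos t ^ 2 + (sqrt (a * b)) ^ 2 * sin t ^ 2))
  (landen a b) (fun t => 1 + a * b / (a ^ 2 * cos t ^ 2 + b ^ 2 * sin t ^ 2)) 0 (PI / 2)).
assert (e0 : landen a b 0 = 0).
{ unfold landen. rewrite sin_0. unfold Rdiv. rewrite !Rmult_0_r, !Rmult_0_l, atan_0. ring. }
assert (e1 : landen a b (PI / 2) = PI).
{ unfold landen. rewrite cos_PI2. unfold Rdiv. rewrite !Rmult_0_r, !Rmult_0_l, atan_0. field. }
rewrite e0, e1 in h.
rewrite gauss_int_half in h by lra.
apply (Rmult_eq_reg_l 2); [|lra]. rewrite <- h; clear h.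
- unfold gauss_int.
  change (2 * RInt (fun t : R => / sqrt (a ^ 2 * cos t ^ 2 + b ^ 2 * sin t ^ 2)) 0 (PI / 2))
   with (scal 2 (RInt (fun t : R => / sqrt (a ^ 2 * cos t ^ 2 + b ^ 2 * sin t ^ 2)) 0 (PI / 2))).
  rewrite <- (RInt_scal (V := R_CompleteNormedModule)) by (now apply gauss_ex_RInt).
  apply RInt_ext; intros t _. rewrite ?scal_mult.
  generalize (landen_den_pos t) (landen_rho t) (gauss_form_pos a b t ha hb); intros hX hr hp.
  destruct (landen_cos_sin t) as [hc hsn]. cbv zeta in hc, hsn.
  set (r := sqrt (a ^ 2 * cos t ^ 2 + b ^ 2 * sin t ^ 2)) in *.
  assert (hr0 : 0 < r) by (apply sqrt_lt_R0, hp).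
  set (X := a * cos t ^ 2 + b * sin t ^ 2) in *.
  assert (hr2 : a ^ 2 * cos t ^ 2 + b ^ 2 * sin t ^ 2 = r ^ 2) by (unfold r; rewrite pow2_sqrt; lra).
  eqR; match goal with |- context [/ sqrt ?Y] => replace (sqrt Y) with ((a + b) / 2 * X / r) end.
  + match goal with |- _ = scal ?x ?y => change (scal x y) with (x * y) end. rewrite hr2.
    assert (e : r ^ 2 + a * b = (a + b) * X) by (rewrite <- hr2; unfold X; rewrite cos2_sin2; ring).
    apply (Rmult_eq_reg_r (r ^ 2 * (a + b) * X)).
    2:{ apply Rgt_not_eq. repeat apply Rmult_lt_0_compat; try apply pow_lt; lra. }
    transitivity (2 * r * ((a + b) * X)); [field; lra|].
    transitivity (2 * r * (r ^ 2 + a * b)); [now rewrite e| field; lra].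
  + symmetry.
    rewrite <- (sqrt_Rsqr ((a + b) / 2 * X / r)).
    2:{ apply Rlt_le, Rdiv_lt_0_compat; [apply Rmult_lt_0_compat|]; lra. }
    f_equal. rewrite hc, hsn.
    rewrite pow2_sqrt by lra. unfold X, Rsqr. field_simplify_eq; [|lra].
    replace (cos t ^ 4) with (cos t ^ 2 * cos t ^ 2) by ring.
    rewrite cos2_sin2; ring.
- intros; apply gauss_continuous; lra.
- intros t _; split; [apply landen_derive|].
  apply continuous_of_derivable; auto_derive.
  generalize (gauss_form_pos a b t ha hb); simpl; intros; lra.
Qed.

End Landen.

(** * Complete elliptic integrals as Gauss integrals *)

Lemma kcomp_sq (k : R) : 0 < k < 1 -> kcomp k ^ 2 = 1 - k ^ 2.
Proof. intro h; unfold kcomp; apply pow2_sqrt; nra. Qed.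

Lemma kcomp_bounds (k : R) : 0 < k < 1 -> 0 < kcomp k < 1.
Proof.
intro h; unfold kcomp; split; [apply sqrt_lt_R0; nra|].
rewrite <- sqrt_1 at 2; apply sqrt_lt_1_alt; nra.
Qed.

Lemma kcomp_invol (k : R) : 0 < k < 1 -> kcomp (kcomp k) = k.
Proof.
intro h. unfold kcomp at 1; rewrite kcomp_sq by assumption.
replace (1 - (1 - k ^ 2)) with (k ^ 2) by ring. apply sqrt_pow2; lra.
Qed.

Lemma ellK_gauss (k : R) : 0 < k < 1 -> ellK k = gauss_int 1 (kcomp k).
Proof.
intro h; unfold ellK, gauss_int; apply RInt_ext; intros t _.
rewrite kcomp_sq, cos2_sin2 by assumption. f_equal; f_equal; ring.
Qed.

Lemma ellK_gauss_div (a b : R) : 0 < b < a -> ellK (kcomp (b / a)) = a * gauss_int a b.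
Proof.
intro h. assert (hq : 0 < b / a < 1).
{ split; [apply Rdiv_lt_0_compat; lra|]. apply (Rmult_lt_reg_r a); [lra|].
  unfold Rdiv; rewrite Rmult_assoc, Rinv_l; lra. }
rewrite ellK_gauss, kcomp_invol by (try apply kcomp_bounds; assumption).
replace (gauss_int a b) with (gauss_int (a * 1) (a * (b / a))).
- rewrite gauss_int_scale by lra. field; lra.
- f_equal; field; lra.
Qed.

Definition period_ratio (k : R) : R := ellK (kcomp k) / ellK k.

Lemma gauss_int_bounds (a b : R) : 0 < b <= a -> PI / 2 / a <= gauss_int a b <= PI / 2 / b.
Proof.
intro h. assert (hpi := PI_RGT_0).
assert (hb : forall t, b <= sqrt (a ^ 2 * cos t ^ 2 + b ^ 2 * sin t ^ 2) <= a).
{ intro t. assert (0 <= sin t ^ 2 <= 1).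
  { split; [apply pow2_ge_0|]. generalize (cos2_sin2 t) (pow2_ge_0 (cos t)); lra. }
  assert (b ^ 2 <= a ^ 2) by (apply pow_incr; lra).
  rewrite cos2_sin2. split.
  - rewrite <- (sqrt_pow2 b) at 1 by lra. apply sqrt_le_1_alt; nra.
  - rewrite <- (sqrt_pow2 a) at 2 by lra. apply sqrt_le_1_alt; nra. }
unfold gauss_int; split.
- replace (PI / 2 / a) with (RInt (fun _ => / a) 0 (PI / 2)).
  2:{ rewrite RInt_const, scal_mult; eqR; field; lra. }
  apply RInt_le; [lra| apply ex_RInt_const | apply gauss_ex_RInt; lra|].
  intros t _; apply Rinv_le_contravar; [|apply hb]. generalize (hb t); lra.
- replace (PI / 2 / b) with (RInt (fun _ => / b) 0 (PI / 2)).
  2:{ rewrite RInt_const, scal_mult; eqR; field; lra. }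
  apply RInt_le; [lra| apply gauss_ex_RInt; lra| apply ex_RInt_const | ].
  intros t _; apply Rinv_le_contravar; [lra|apply hb].
Qed.

Lemma ellK_bounds (k : R) : 0 < k < 1 -> PI / 2 <= ellK k <= PI / 2 / kcomp k.
Proof.
intro h; rewrite ellK_gauss by assumption.
destruct (kcomp_bounds k h).
generalize (gauss_int_bounds 1 (kcomp k)). rewrite Rdiv_1_r; intros H1; apply H1; lra.
Qed.

(** For k' = b/a the ratio K'/K is the Gauss integral of (a, sqrt (a^2 - b^2)) over that of (a, b).
    The step preserves the denominator. It replaces the numerator by the integral of ((a + b)/2, (a
    - b)/2), half of a pair whose own mean step is (a, sqrt (a^2 - b^2)); halving the pair doubles
    the integral. *)
Lemma period_ratio_landen (a b a1 b1 : R) : 0 < b < a -> a1 = (a + b) / 2 -> b1 = sqrt (a * b) ->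
  period_ratio (kcomp (b1 / a1)) = 2 * period_ratio (kcomp (b / a)).
Proof.
intros h ea eb.
assert (hab : 0 < a * b) by nra.
assert (h1 : 0 < b1) by (subst; apply sqrt_lt_R0, hab).
assert (h2 : b1 ^ 2 = a * b) by (subst; apply pow2_sqrt; lra).
assert (h3 : 0 < b1 < a1) by (split; nra).
assert (hq : 0 < b / a < 1).
{ split; [apply Rdiv_lt_0_compat; lra|]. apply (Rmult_lt_reg_r a); [lra|].
  unfold Rdiv; rewrite Rmult_assoc, Rinv_l; lra. }
assert (hq1 : 0 < b1 / a1 < 1).
{ split; [apply Rdiv_lt_0_compat; lra|]. apply (Rmult_lt_reg_r a1); [lra|].
  unfold Rdiv; rewrite Rmult_assoc, Rinv_l; lra. }
unfold period_ratio. rewrite !kcomp_invol, !ellK_gauss_div by assumption.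
assert (hg : gauss_int a1 b1 = gauss_int a b) by (subst; symmetry; apply gauss_int_agm; lra).
rewrite hg.
(* The complementary modulus of [(a1, b1)] comes from the AGM step of [(a + b, a - b)]. *)
assert (h' : ellK (b1 / a1) = 2 * a1 * gauss_int a (sqrt (a * a - b * b))).
{ rewrite <- (kcomp_invol (b1 / a1)) by assumption.
  assert (e : kcomp (b1 / a1) = (a - b) / (a + b)).
  { unfold kcomp. rewrite <- (sqrt_pow2 ((a - b) / (a + b))).
    - f_equal. replace ((b1 / a1) ^ 2) with (b1 ^ 2 / a1 ^ 2) by (field; lra).
      rewrite h2, ea; field; lra.
    - apply Rlt_le, Rdiv_lt_0_compat; lra. }
  rewrite e, ellK_gauss_div by lra. rewrite gauss_int_agm by lra.
  replace ((a + b + (a - b)) / 2) with a by field.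
  replace ((a + b) * (a - b)) with (a * a - b * b) by ring. rewrite ea; field. }
assert (h'' : ellK (b / a) = a * gauss_int a (sqrt (a * a - b * b))).
{ rewrite <- (kcomp_invol (b / a)) by assumption.
  replace (kcomp (b / a)) with (sqrt (a * a - b * b) / a).
  - apply ellK_gauss_div. split; [apply sqrt_lt_R0; nra|].
    rewrite <- (sqrt_pow2 a) at 3 by lra. apply sqrt_lt_1_alt; nra.
  - unfold kcomp. rewrite <- (sqrt_pow2 a) at 3 by lra. rewrite <- sqrt_div_alt by (apply pow_lt; lra).
    f_equal; field; lra. }
rewrite h', h''.
assert (0 < gauss_int a b).
{ generalize (gauss_int_bounds a b). intros H1.
  apply Rlt_le_trans with (PI / 2 / a); [|apply H1; lra].
  generalize PI_RGT_0; intro; apply Rdiv_lt_0_compat; lra. }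
field; repeat split; lra.
Qed.

(** * Legendre's relation and the derivative of the period ratio *)

Lemma ell_form_pos (k t : R) : 0 < k < 1 -> 0 < 1 - k ^ 2 * sin t ^ 2.
Proof.
intro h. generalize (gauss_form_pos 1 (kcomp k) t).
rewrite kcomp_sq, cos2_sin2 by assumption. destruct (kcomp_bounds k h) as [h0 _]. intro hp.
specialize (hp Rlt_0_1 h0). lra.
Qed.

(** The complete integral of the second kind: the derivative of K leaves the multiples of K, but K
    and E together are closed under differentiation. *)
Definition ellE (k : R) : R := RInt (fun t => sqrt (1 - k ^ 2 * sin t ^ 2)) 0 (PI / 2).

Lemma is_derive_RInt_modulus (f df : R -> R -> R) (k : R) :
  0 < k < 1 ->
  (forall u t, 0 < u < 1 -> is_derive (fun z => f z t) u (df u t)) ->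
  (forall u t, 0 < u < 1 -> continuity_2d_pt df u t) ->
  (forall u t, 0 < u < 1 -> continuous (f u) t) ->
  is_derive (fun u => RInt (f u) 0 (PI / 2)) k (RInt (df k) 0 (PI / 2)).
Proof.
intros hk hd hc hf.
assert (hl : locally k (fun u => 0 < u < 1)).
{ apply (open_and (fun u => 0 < u) (fun u => u < 1)); [apply open_gt | apply open_lt | exact hk]. }
rewrite (RInt_ext (df k) (fun t => Derive (fun u => f u t) k)).
2:{ intros t _; symmetry; now apply is_derive_unique, hd. }
apply is_derive_RInt_param.
- apply filter_imp with (2 := hl). intros u hu t _. eexists; now apply hd.
- intros t _. apply continuity_2d_pt_ext_loc with df; [|now apply hc].
  destruct hl as [e he]. exists e. intros u v hu _. symmetry. apply is_derive_unique, hd, he, hu.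
- apply filter_imp with (2 := hl). intros u hu.
  apply (ex_RInt_continuous (V := R_CompleteNormedModule)); intros; now apply hf.
Qed.

Lemma continuity_2d_pt_ell (u t : R) :
  continuity_2d_pt (fun u t => 1 - u ^ 2 * sin t ^ 2) u t.
Proof.
apply continuity_2d_pt_minus; [apply continuity_2d_pt_const|].
apply continuity_2d_pt_mult.
- apply (continuity_1d_2d_pt_comp (fun x => x ^ 2) (fun u t => u)); [|apply continuity_2d_pt_id1].
  apply derivable_continuous_pt, derivable_pt_pow.
- apply (continuity_1d_2d_pt_comp (fun x => sin x ^ 2) (fun u t => t)); [|apply continuity_2d_pt_id2].
  apply continuity_pt_filterlim, continuous_of_derivable. auto_derive; exact I.
Qed.

Lemma continuity_2d_pt_usin (u t : R) :
  continuity_2d_pt (fun u t => u * sin t ^ 2) u t.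
Proof.
apply continuity_2d_pt_mult; [apply continuity_2d_pt_id1|].
apply (continuity_1d_2d_pt_comp (fun x => sin x ^ 2) (fun u t => t)); [|apply continuity_2d_pt_id2].
apply continuity_pt_filterlim, continuous_of_derivable. auto_derive; exact I.
Qed.

Lemma continuity_2d_pt_sqrt_ell (u t : R) : 0 < u < 1 ->
  continuity_2d_pt (fun u t => sqrt (1 - u ^ 2 * sin t ^ 2)) u t.
Proof.
intro h. apply (continuity_1d_2d_pt_comp sqrt (fun u t => 1 - u ^ 2 * sin t ^ 2)).
- apply continuity_pt_sqrt, Rlt_le, ell_form_pos, h.
- apply continuity_2d_pt_ell.
Qed.

Ltac ell_side := unfold Rminus in *; simpl in *; repeat split; try lra;
  try (apply Rgt_not_eq; repeat apply Rmult_lt_0_compat; lra).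

Section Modulus.
Variable k : R.
Hypothesis hk : 0 < k < 1.

Lemma ell_sqrt_pos (t : R) : 0 < sqrt (1 - k ^ 2 * sin t ^ 2).
Proof. apply sqrt_lt_R0, ell_form_pos, hk. Qed.

Let ell_ex_RInt (f : R -> R) : (forall t, ex_derive f t) -> ex_RInt f 0 (PI / 2).
Proof.
intro h; apply (ex_RInt_continuous (V := R_CompleteNormedModule)); intros.
apply continuous_of_derivable, h.
Qed.

Lemma ellK_ex_RInt : ex_RInt (fun t => / sqrt (1 - k ^ 2 * sin t ^ 2)) 0 (PI / 2).
Proof.
apply ell_ex_RInt; intro t; auto_derive.
generalize (ell_form_pos k t hk) (ell_sqrt_pos t); intros; ell_side.
Qed.

Lemma ellE_ex_RInt : ex_RInt (fun t => sqrt (1 - k ^ 2 * sin t ^ 2)) 0 (PI / 2).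
Proof.
apply ell_ex_RInt; intro t; auto_derive.
generalize (ell_form_pos k t hk) (ell_sqrt_pos t); intros; ell_side.
Qed.

Lemma ell3_ex_RInt : ex_RInt (fun t => / sqrt (1 - k ^ 2 * sin t ^ 2) ^ 3) 0 (PI / 2).
Proof.
apply ell_ex_RInt; intro t; auto_derive.
generalize (ell_form_pos k t hk) (ell_sqrt_pos t); intros; ell_side.
Qed.

Let sq t : sqrt (1 - k ^ 2 * sin t ^ 2) ^ 2 = 1 - k ^ 2 * sin t ^ 2.
Proof. apply pow2_sqrt, Rlt_le, ell_form_pos, hk. Qed.

(* [k^2 sin t cos t / sqrt (1 - k^2 sin^2 t)] vanishes at both ends and has derivative
   [sqrt (1 - k^2 sin^2 t) - k'^2 / sqrt (1 - k^2 sin^2 t) ^ 3]. *)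
Lemma ell3_int :
  RInt (fun t => / sqrt (1 - k ^ 2 * sin t ^ 2) ^ 3) 0 (PI / 2) = ellE k / (1 - k ^ 2).
Proof.
assert (h1 : 0 < 1 - k ^ 2) by nra.
assert (h : is_RInt (fun t => sqrt (1 - k ^ 2 * sin t ^ 2)
      - (1 - k ^ 2) * / sqrt (1 - k ^ 2 * sin t ^ 2) ^ 3) 0 (PI / 2) 0).
{ replace 0 with (minus (k ^ 2 * sin (PI / 2) * cos (PI / 2) / sqrt (1 - k ^ 2 * sin (PI / 2) ^ 2))
     (k ^ 2 * sin 0 * cos 0 / sqrt (1 - k ^ 2 * sin 0 ^ 2))) at 2.
  2:{ rewrite cos_PI2, sin_0. unfold minus, plus, opp; simpl. unfold Rdiv; ring. }
  apply (is_RInt_derive (fun t => k ^ 2 * sin t * cos t / sqrt (1 - k ^ 2 * sin t ^ 2))).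
  - intros t _. generalize (ell_form_pos k t hk) (ell_sqrt_pos t) (sq t). intros hp hs e.
    auto_derive.
    + ell_side.
    + change (k * (k * 1)) with (k ^ 2). change (sin t * (sin t * 1)) with (sin t ^ 2).
      set (r := sqrt (1 + - (k ^ 2 * sin t ^ 2))) in *.
      change (sqrt (1 - k ^ 2 * sin t ^ 2)) with r in *.
      assert (hr : r <> 0) by lra.
      field_simplify_eq; [|assumption].
      replace (r ^ 4) with (r ^ 2 * r ^ 2) by ring. rewrite e.
      replace (cos t ^ 2) with (1 - sin t ^ 2) by (symmetry; apply cos2_sin2). ring.
  - intros t _. generalize (ell_form_pos k t hk) (ell_sqrt_pos t). intros hp hs.
    apply continuous_of_derivable. auto_derive. ell_side. }
apply (is_RInt_unique (V := R_CompleteNormedModule)) in h.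
rewrite (RInt_minus (V := R_CompleteNormedModule) (fun t => sqrt (1 - k ^ 2 * sin t ^ 2))
   (fun t => (1 - k ^ 2) * / sqrt (1 - k ^ 2 * sin t ^ 2) ^ 3)) in h.
- rewrite (RInt_scal (V := R_CompleteNormedModule) (fun t => / sqrt (1 - k ^ 2 * sin t ^ 2) ^ 3)) in h.
  + change (ellE k - (1 - k ^ 2) * RInt (fun t => / sqrt (1 - k ^ 2 * sin t ^ 2) ^ 3) 0 (PI / 2) = 0) in h.
    apply (Rmult_eq_reg_l (1 - k ^ 2)); [|lra]. eqR; field_simplify; lra.
  + apply ell3_ex_RInt.
- apply ellE_ex_RInt.
- apply (ex_RInt_scal (V := R_NormedModule) _ _ _ (1 - k ^ 2)), ell3_ex_RInt.
Qed.

(** Write D for the square root. Since k^2 sin^2 t = 1 - D^2, the differentiated integrand k sin^2 t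
    / D^3 is (D^-3 - D^-1) / k, and [ell3_int] expresses the integral of D^-3 through E. *)
Lemma ellK_derive : is_derive ellK k ((ellE k / (1 - k ^ 2) - ellK k) / k).
Proof.
replace ((ellE k / (1 - k ^ 2) - ellK k) / k)
  with (RInt (fun t => k * sin t ^ 2 * / sqrt (1 - k ^ 2 * sin t ^ 2) ^ 3) 0 (PI / 2)).
- apply (is_derive_RInt_modulus (fun k t => / sqrt (1 - k ^ 2 * sin t ^ 2))
    (fun k t => k * sin t ^ 2 * / sqrt (1 - k ^ 2 * sin t ^ 2) ^ 3)); try exact hk; clear - k.
  + intros u t h. generalize (ell_form_pos u t h); intro hp.
    assert (hs := sqrt_lt_R0 _ hp).
    auto_derive; [ell_side|].
    change (u * (u * 1)) with (u ^ 2). change (sin t * (sin t * 1)) with (sin t ^ 2).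
    change (1 + - (u ^ 2 * sin t ^ 2)) with (1 - u ^ 2 * sin t ^ 2).
    simpl pow. field. simpl in hs. lra.
  + intros u t h. apply continuity_2d_pt_mult; [apply continuity_2d_pt_usin|].
    apply continuity_2d_pt_inv.
    * apply (continuity_1d_2d_pt_comp (fun x => x ^ 3)); [|now apply continuity_2d_pt_sqrt_ell].
      apply derivable_continuous_pt, derivable_pt_pow.
    * apply pow_nonzero, Rgt_not_eq, sqrt_lt_R0, ell_form_pos, h.
  + intros u t h. generalize (ell_form_pos u t h); intro hp.
    assert (hs := sqrt_lt_R0 _ hp).
    apply continuous_of_derivable; auto_derive. ell_side.
- rewrite <- ell3_int.
  rewrite (RInt_ext _ (fun t => scal (/ k) (minus (/ sqrt (1 - k ^ 2 * sin t ^ 2) ^ 3)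
     (/ sqrt (1 - k ^ 2 * sin t ^ 2))))).
  + rewrite (RInt_scal (V := R_CompleteNormedModule)).
    * rewrite (RInt_minus (V := R_CompleteNormedModule)).
      -- unfold Rdiv. rewrite Rmult_comm; reflexivity.
      -- apply ell3_ex_RInt.
      -- apply ellK_ex_RInt.
    * apply (ex_RInt_minus (V := R_NormedModule)); [apply ell3_ex_RInt | apply ellK_ex_RInt].
  + intros t _. generalize (ell_sqrt_pos t) (sq t); intros hs e.
    change (k * sin t ^ 2 * / sqrt (1 - k ^ 2 * sin t ^ 2) ^ 3 = / k *
      (/ sqrt (1 - k ^ 2 * sin t ^ 2) ^ 3 - / sqrt (1 - k ^ 2 * sin t ^ 2))).
    set (r := sqrt (1 - k ^ 2 * sin t ^ 2)) in *.
    apply (Rmult_eq_reg_r (r ^ 3 * k)).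
    2:{ apply Rgt_not_eq, Rmult_lt_0_compat; [apply pow_lt|]; lra. }
    transitivity (k ^ 2 * sin t ^ 2); [field; lra|].
    transitivity (1 - r ^ 2); [rewrite e; ring | field; lra].
Qed.

Lemma ellE_derive : is_derive ellE k ((ellE k - ellK k) / k).
Proof.
replace ((ellE k - ellK k) / k)
  with (RInt (fun t => - (k * sin t ^ 2) * / sqrt (1 - k ^ 2 * sin t ^ 2)) 0 (PI / 2)).
- apply (is_derive_RInt_modulus (fun k t => sqrt (1 - k ^ 2 * sin t ^ 2))
    (fun k t => - (k * sin t ^ 2) * / sqrt (1 - k ^ 2 * sin t ^ 2))); try exact hk; clear - k.
  + intros u t h. generalize (ell_form_pos u t h); intro hp.
    assert (hs := sqrt_lt_R0 _ hp).
    auto_derive; [ell_side|].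
    change (u * (u * 1)) with (u ^ 2). change (sin t * (sin t * 1)) with (sin t ^ 2).
    change (1 + - (u ^ 2 * sin t ^ 2)) with (1 - u ^ 2 * sin t ^ 2).
    simpl pow. field. simpl in hs. lra.
  + intros u t h. apply continuity_2d_pt_mult.
    * apply continuity_2d_pt_opp, continuity_2d_pt_usin.
    * apply continuity_2d_pt_inv; [now apply continuity_2d_pt_sqrt_ell|].
      apply Rgt_not_eq, sqrt_lt_R0, ell_form_pos, h.
  + intros u t h. generalize (ell_form_pos u t h); intro hp.
    assert (hs := sqrt_lt_R0 _ hp).
    apply continuous_of_derivable; auto_derive. ell_side.
- rewrite (RInt_ext _ (fun t => scal (/ k) (minus (sqrt (1 - k ^ 2 * sin t ^ 2))
     (/ sqrt (1 - k ^ 2 * sin t ^ 2))))).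
  + rewrite (RInt_scal (V := R_CompleteNormedModule)).
    * rewrite (RInt_minus (V := R_CompleteNormedModule)).
      -- unfold Rdiv. rewrite Rmult_comm; reflexivity.
      -- apply ellE_ex_RInt.
      -- apply ellK_ex_RInt.
    * apply (ex_RInt_minus (V := R_NormedModule)); [apply ellE_ex_RInt | apply ellK_ex_RInt].
  + intros t _. generalize (ell_sqrt_pos t) (sq t); intros hs e.
    change (- (k * sin t ^ 2) * / sqrt (1 - k ^ 2 * sin t ^ 2) = / k *
      (sqrt (1 - k ^ 2 * sin t ^ 2) - / sqrt (1 - k ^ 2 * sin t ^ 2))).
    set (r := sqrt (1 - k ^ 2 * sin t ^ 2)) in *.
    apply (Rmult_eq_reg_r (r * k)).
    2:{ apply Rgt_not_eq, Rmult_lt_0_compat; lra. }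
    transitivity (- (k ^ 2 * sin t ^ 2)); [field; lra|].
    transitivity (r ^ 2 - 1); [rewrite e; ring | field; lra].
Qed.

Lemma kcomp_derive : is_derive kcomp k (- k / kcomp k).
Proof.
destruct (kcomp_bounds k hk) as [h _].
unfold kcomp in *. auto_derive; [nra|]. unfold Rminus in *. simpl in *.
field; lra.
Qed.

(** At the complementary modulus the radicand is cos^2 t + k^2 sin^2 t, which lies between cos^2 t
    and (cos t + k)^2 on the range of integration. *)
Lemma ellE_bounds : 1 <= ellE (kcomp k) <= 1 + k * (PI / 2).
Proof.
assert (hpi := PI_RGT_0).
assert (hq := kcomp_bounds k hk).
assert (ex : ex_RInt (fun t => sqrt (1 - kcomp k ^ 2 * sin t ^ 2)) 0 (PI / 2)).
{ apply (ex_RInt_continuous (V := R_CompleteNormedModule)); intros.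
  apply continuous_of_derivable; auto_derive.
  generalize (ell_form_pos _ z hq); simpl; lra. }
assert (hc : is_RInt cos 0 (PI / 2) 1).
{ replace 1 with (minus (sin (PI / 2)) (sin 0)).
  - apply (is_RInt_derive sin cos); intros t _; [auto_derive; [exact I | ring]|].
    apply continuous_of_derivable; auto_derive; exact I.
  - rewrite sin_PI2, sin_0. unfold minus, plus, opp; simpl; ring. }
assert (hc' : is_RInt (fun t => cos t + k) 0 (PI / 2) (1 + k * (PI / 2))).
{ apply (is_RInt_plus (V := R_NormedModule) cos (fun _ => k)); [exact hc|].
  replace (k * (PI / 2)) with (scal (PI / 2 - 0) k) by (rewrite scal_mult; eqR; ring).
  apply (is_RInt_const (V := R_NormedModule)). }
assert (e : forall t, 1 - kcomp k ^ 2 * sin t ^ 2 = cos t ^ 2 + k ^ 2 * sin t ^ 2).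
{ intro t; rewrite kcomp_sq, cos2_sin2 by assumption; ring. }
unfold ellE; split.
- apply Rle_trans with (RInt cos 0 (PI / 2)).
  { apply Req_le; symmetry; exact (is_RInt_unique _ _ _ _ hc). }
  apply RInt_le; [lra | eexists; exact hc | exact ex |].
  intros t ht. rewrite e. rewrite <- (sqrt_pow2 (cos t)) at 1.
  + apply sqrt_le_1_alt. assert (0 <= k ^ 2 * sin t ^ 2); [|lra].
    apply Rmult_le_pos; apply pow2_ge_0.
  + apply cos_ge_0; lra.
- apply Rle_trans with (RInt (fun t => cos t + k) 0 (PI / 2)).
  2:{ apply Req_le; exact (is_RInt_unique _ _ _ _ hc'). }
  apply RInt_le; [lra | exact ex | eexists; exact hc' |].
  intros t ht. rewrite e.
  assert (0 <= cos t) by (apply cos_ge_0; lra).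
  rewrite <- (sqrt_pow2 (cos t + k)) by lra. apply sqrt_le_1_alt.
  assert (0 <= sin t ^ 2 <= 1).
  { split; [apply pow2_ge_0|]. generalize (cos2_sin2 t) (pow2_ge_0 (cos t)); lra. }
  assert (0 <= k ^ 2) by apply pow2_ge_0. nra.
Qed.

(** The integrand of K - E is k^2 sin^2 t over the square root. The factor k^2 is what matters as k
    -> 0: it outweighs [ellK (kcomp k)], bounded there by a multiple of 1/k. *)
Lemma ellK_sub_ellE : 0 <= ellK k - ellE k <= k ^ 2 * ellK k.
Proof.
assert (hpi := PI_RGT_0).
unfold ellK, ellE.
assert (hle : forall t, 0 <= k ^ 2 * sin t ^ 2 <= k ^ 2).
{ intro t. assert (0 <= sin t ^ 2 <= 1).
  { split; [apply pow2_ge_0|]. generalize (cos2_sin2 t) (pow2_ge_0 (cos t)); lra. }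
  assert (0 <= k ^ 2) by apply pow2_ge_0. nra. }
split.
- apply -> Rminus_le_0; apply RInt_le; [lra | apply ellE_ex_RInt | apply ellK_ex_RInt |].
  intros t _. generalize (ell_sqrt_pos t) (sq t) (hle t); intros hs e h.
  set (r := sqrt (1 - k ^ 2 * sin t ^ 2)) in *.
  apply (Rmult_le_reg_r r); [lra|]. rewrite Rinv_l by lra. nra.
- apply Rplus_le_reg_r with (RInt (fun t => sqrt (1 - k ^ 2 * sin t ^ 2)) 0 (PI / 2)
    - k ^ 2 * RInt (fun t => / sqrt (1 - k ^ 2 * sin t ^ 2)) 0 (PI / 2)).
  ring_simplify.
  apply Rle_trans with ((1 - k ^ 2) * RInt (fun t => / sqrt (1 - k ^ 2 * sin t ^ 2)) 0 (PI / 2)).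
  { apply Req_le; ring. }
  change ((1 - k ^ 2) * RInt (fun t => / sqrt (1 - k ^ 2 * sin t ^ 2)) 0 (PI / 2))
    with (scal (1 - k ^ 2) (RInt (fun t => / sqrt (1 - k ^ 2 * sin t ^ 2)) 0 (PI / 2))).
  rewrite <- (RInt_scal (V := R_CompleteNormedModule)) by apply ellK_ex_RInt.
  apply RInt_le; [lra | apply (ex_RInt_scal (V := R_NormedModule)), ellK_ex_RInt | apply ellE_ex_RInt |].
  intros t _. generalize (ell_sqrt_pos t) (sq t) (hle t); intros hs e h.
  change ((1 - k ^ 2) * / sqrt (1 - k ^ 2 * sin t ^ 2) <= sqrt (1 - k ^ 2 * sin t ^ 2)).
  set (r := sqrt (1 - k ^ 2 * sin t ^ 2)) in *.
  apply (Rmult_le_reg_r r); [lra|]. rewrite Rmult_assoc, Rinv_l by lra. nra.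
Qed.

End Modulus.

Lemma const_of_derive_0 (f : R -> R) : (forall x, 0 < x < 1 -> is_derive f x 0) ->
  forall x y, 0 < x < 1 -> 0 < y < 1 -> f x = f y.
Proof.
intros hd x y hx hy.
assert (hxy : forall t, Rmin x y <= t <= Rmax x y -> 0 < t < 1).
{ intros t [h1 h2]. split.
  - apply Rlt_le_trans with (2 := h1). apply Rmin_glb_lt; lra.
  - apply Rle_lt_trans with (1 := h2). apply Rmax_lub_lt; lra. }
destruct (MVT_gen f x y (fun _ => 0)) as [c [_ h]].
- intros t ht; apply hd, hxy; lra.
- intros t ht; apply continuity_pt_filterlim, continuous_of_derivable. eexists; apply hd, hxy, ht.
- lra.
Qed.

(** The left side has derivative 0, hence is constant; its distance from PI/2 is at most a multiple
    of x at every x in (0, 1/2], which fixes the constant. *)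
Lemma legendre_relation (k : R) : 0 < k < 1 ->
  ellE k * ellK (kcomp k) + ellE (kcomp k) * ellK k - ellK k * ellK (kcomp k) = PI / 2.
Proof.
set (L := fun k => ellE k * ellK (kcomp k) + ellE (kcomp k) * ellK k - ellK k * ellK (kcomp k)).
assert (hd : forall x, 0 < x < 1 -> is_derive L x 0).
{ clear k; intros k hk. assert (hq := kcomp_bounds k hk). assert (e := kcomp_sq k hk).
  assert (dE := ellE_derive k hk). assert (dK := ellK_derive k hk).
  assert (dE' := is_derive_comp ellE kcomp k _ _ (ellE_derive _ hq) (kcomp_derive k hk)).
  assert (dK' := is_derive_comp ellK kcomp k _ _ (ellK_derive _ hq) (kcomp_derive k hk)).
  assert (d := is_derive_minus _ _ _ _ _ (is_derive_plus _ _ _ _ _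
     (is_derive_mult _ _ _ _ _ dE dK' Rmult_comm) (is_derive_mult _ _ _ _ _ dE' dK Rmult_comm))
     (is_derive_mult _ _ _ _ _ dK dK' Rmult_comm)).
  unfold L. match type of d with is_derive _ _ ?l => replace 0 with l end; [exact d|].
  unfold minus, plus, mult, opp, scal; simpl; unfold mult; simpl.
  change (k * (k * 1)) with (k ^ 2). change (kcomp k * (kcomp k * 1)) with (kcomp k ^ 2).
  eqR. rewrite e.
  replace (1 - (1 - k ^ 2)) with (k ^ 2) by ring.
  field_simplify_eq; [|repeat split; nra].
  replace (kcomp k ^ 4) with (kcomp k ^ 2 * kcomp k ^ 2) by ring.
  rewrite e. ring. }
intro hk. change (L k = PI / 2).
assert (hP : 0 < PI / 2) by (generalize PI_RGT_0; lra).
set (P := PI / 2) in *.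
assert (hb : forall x, 0 < x <= 1 / 2 -> Rabs (L x - P) <= (4 * P ^ 2 + 2 * P) * x).
{ intros x hx. assert (hx' : 0 < x < 1) by lra.
  assert (hq := kcomp_bounds x hx'). assert (e := kcomp_sq x hx').
  assert (b1 := ellK_bounds x hx'). assert (b2 := ellK_bounds _ hq).
  assert (b3 := ellE_bounds x hx'). assert (b4 := ellK_sub_ellE x hx').
  rewrite kcomp_invol in b2 by assumption. fold P in b1, b2, b3.
  assert (h1 : 1 - x <= kcomp x) by nra.
  assert (h2 : P / kcomp x <= P * (1 + 2 * x)).
  { unfold Rdiv; apply Rmult_le_compat_l; [lra|].
    apply (Rmult_le_reg_r (kcomp x)); [lra|]. rewrite Rinv_l by lra. nra. }
  unfold L. set (K := ellK x) in *. set (K' := ellK (kcomp x)) in *.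
  set (E' := ellE (kcomp x)) in *.
  (* This grouping pairs K', the only factor that blows up, with K - E = O(x^2). *)
  replace (ellE x * K' + E' * K - K * K' - P) with (E' * K - P - (K - ellE x) * K') by ring.
  assert (h3 : 0 <= (K - ellE x) * K' <= 2 * P ^ 2 * x).
  { assert (0 <= K') by lra. split; [apply Rmult_le_pos; lra|].
    apply Rle_trans with (x ^ 2 * K * (P / x)); [apply Rmult_le_compat; lra|].
    replace (x ^ 2 * K * (P / x)) with (x * P * K) by (field; lra).
    replace (2 * P ^ 2 * x) with (x * P * (2 * P)) by ring.
    apply Rmult_le_compat_l; [apply Rmult_le_pos; lra|]. nra. }
  assert (h4 : 0 <= E' * K - P <= (2 * P + 2 * P ^ 2) * x).
  { split; [nra|].
    assert (E' * K <= (1 + x * P) * (P * (1 + 2 * x))) by (apply Rmult_le_compat; lra).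
    assert (x * x * P ^ 2 <= x * (1 / 2) * P ^ 2).
    { apply Rmult_le_compat_r; [apply pow2_ge_0|nra]. }
    nra. }
  apply Rabs_le; split; nra. }
destruct (Req_dec (L k) P) as [|hne]; [assumption|exfalso].
set (d := Rabs (L k - P)) in *.
assert (hd0 : 0 < d) by (apply Rabs_pos_lt; lra).
set (C := 4 * P ^ 2 + 2 * P) in *. assert (hC : 0 < C) by (unfold C; nra).
(* Small enough that the linear bound C x is at most half of the supposed discrepancy d. *)
set (x := Rmin (1 / 2) (d / (2 * C))).
assert (hx : 0 < x <= 1 / 2).
{ split; [apply Rmin_glb_lt; [lra | apply Rdiv_lt_0_compat; lra] | apply Rmin_l]. }
specialize (hb x hx). rewrite (const_of_derive_0 L hd x k) in hb by lra. fold d in hb.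
assert (C * x <= d / 2); [|lra].
apply Rle_trans with (C * (d / (2 * C))); [|apply Req_le; field; lra].
apply Rmult_le_compat_l; [lra | apply Rmin_r].
Qed.

Lemma ellK_pos (k : R) : 0 < k < 1 -> 0 < ellK k.
Proof. intro h; generalize (ellK_bounds k h) PI_RGT_0; lra. Qed.

(** The numerator of the quotient rule is the left side of Legendre's relation times - 1 / (k
    k'^2). *)
Lemma period_ratio_derive (k : R) : 0 < k < 1 ->
  is_derive period_ratio k (- PI / (2 * k * (1 - k ^ 2) * ellK k ^ 2)).
Proof.
intro hk. assert (hq := kcomp_bounds k hk). assert (e := kcomp_sq k hk).
assert (hK := ellK_pos k hk).
assert (d := is_derive_div _ _ _ _ _
   (is_derive_comp ellK kcomp k _ _ (ellK_derive _ hq) (kcomp_derive k hk))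
   (ellK_derive k hk) (Rgt_not_eq _ _ hK)).
unfold period_ratio. match type of d with is_derive _ _ ?l =>
  replace (- PI / (2 * k * (1 - k ^ 2) * ellK k ^ 2)) with l end; [exact d|].
match goal with |- context [scal ?x ?y] => change (scal x y) with (x * y) end.
replace PI with (2 * (PI / 2)) by field.
rewrite <- (legendre_relation k hk).
rewrite e. replace (1 - (1 - k ^ 2)) with (k ^ 2) by ring.
field_simplify_eq; [|repeat split; nra].
try replace (kcomp k ^ 4) with (kcomp k ^ 2 * kcomp k ^ 2) by ring.
rewrite e. ring.
Qed.

Lemma period_ratio_pos (k : R) : 0 < k < 1 -> 0 < period_ratio k.
Proof. intro h; apply Rdiv_lt_0_compat; apply ellK_pos; [now apply kcomp_bounds | exact h]. Qed.

Lemma is_derive_MVT (f df : R -> R) (x y : R) : x < y ->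
  (forall t, x <= t <= y -> is_derive f t (df t)) ->
  exists c, x <= c <= y /\ f y - f x = df c * (y - x).
Proof.
intros h hd.
destruct (MVT_gen f x y df) as [c hc].
- intros t; rewrite Rmin_left, Rmax_right by lra; intro; apply hd; lra.
- intros t; rewrite Rmin_left, Rmax_right by lra; intro.
  apply continuity_pt_filterlim, continuous_of_derivable. eexists; apply hd; lra.
- exists c. rewrite Rmin_left, Rmax_right in hc by lra. exact hc.
Qed.

Lemma period_ratio_decr (x y : R) : 0 < x -> x < y -> y < 1 -> period_ratio y < period_ratio x.
Proof.
intros h0 h h1.
destruct (is_derive_MVT _ _ x y h (fun t ht => period_ratio_derive t ltac:(lra))) as [c [hc e]].
assert (hK := ellK_pos c ltac:(lra)).
assert (0 < PI / (2 * c * (1 - c ^ 2) * ellK c ^ 2)).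
{ apply Rdiv_lt_0_compat; [apply PI_RGT_0|].
  repeat apply Rmult_lt_0_compat; try apply pow_lt; nra. }
replace (- PI / (2 * c * (1 - c ^ 2) * ellK c ^ 2))
  with (- (PI / (2 * c * (1 - c ^ 2) * ellK c ^ 2))) in e by (unfold Rdiv; ring).
nra.
Qed.

Lemma period_ratio_inj (x y : R) : 0 < x < 1 -> 0 < y < 1 ->
  period_ratio x = period_ratio y -> x = y.
Proof.
intros hx hy e. destruct (Rtotal_order x y) as [h|[h|h]]; [|exact h|].
- generalize (period_ratio_decr x y); lra.
- generalize (period_ratio_decr y x); lra.
Qed.

Lemma period_ratio_log_bound :
  exists C, forall k, 0 < k <= 1 / 2 -> Rabs (period_ratio k + 2 / PI * ln k) <= C.
Proof.
set (f := fun k => period_ratio k + 2 / PI * ln k).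
assert (hpi := PI_RGT_0).
exists (Rabs (f (1 / 2)) + 2 / PI). intros k hk. fold (f k).
destruct (Req_dec k (1 / 2)) as [->|hne].
{ assert (0 < 2 / PI) by (apply Rdiv_lt_0_compat; lra). lra. }
destruct (is_derive_MVT f (fun t => - PI / (2 * t * (1 - t ^ 2) * ellK t ^ 2) + 2 / PI * / t)
  k (1 / 2)) as [c [hc e]]; [lra| |].
{ intros t ht. apply (is_derive_plus (V := R_NormedModule)).
  - apply period_ratio_derive; lra.
  - auto_derive; [lra | field; lra]. }
assert (hc' : 0 < c < 1) by lra.
assert (b := ellK_bounds c hc'). assert (hq := kcomp_bounds c hc'). assert (es := kcomp_sq c hc').
rewrite <- es in e.
set (K := ellK c) in *. set (q := kcomp c) in *.
assert (hqK : q * K <= PI / 2).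
{ apply Rle_trans with (q * (PI / 2 / q)); [apply Rmult_le_compat_l; lra | apply Req_le; field; lra]. }
assert (hqK0 : q * (PI / 2) <= q * K) by (apply Rmult_le_compat_l; lra).
(* The derivative is [2 / (PI c) (1 - (PI / 2)^2 / (c' K)^2)] and [c' PI / 2 <= c' K <= PI / 2]. *)
assert (hdf : - (2 / PI) * 2 <= - PI / (2 * c * q ^ 2 * K ^ 2) + 2 / PI * / c <= 0).
{ set (w := q * K) in *.
  replace (- PI / (2 * c * q ^ 2 * K ^ 2) + 2 / PI * / c)
   with (2 / PI * / c * (1 - (PI / 2 / w) ^ 2)) by (unfold w; field; repeat split; nra).
  assert (hw : 0 < w) by nra.
  assert (h1 : 1 <= PI / 2 / w).
  { apply (Rmult_le_reg_r w); [lra|]. unfold Rdiv; rewrite (Rmult_assoc _ (/ w)), Rinv_l; lra. }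
  assert (h2 : PI / 2 / w <= / q).
  { apply (Rmult_le_reg_r (w * q)); [nra|]. field_simplify; nra. }
  assert (h3 : (PI / 2 / w) ^ 2 <= (/ q) ^ 2) by (apply pow_incr; lra).
  assert (h4 : 1 - (/ q) ^ 2 = - c ^ 2 / q ^ 2).
  { replace (c ^ 2) with (1 - q ^ 2) by lra. field; lra. }
  assert (h5 : - (2 * c) <= - c ^ 2 / q ^ 2).
  { apply (Rmult_le_reg_r (q ^ 2)); [nra|]. unfold Rdiv. rewrite Rmult_assoc, Rinv_l by nra. nra. }
  assert (h6 : 0 < 2 / PI * / c)
    by (apply Rmult_lt_0_compat; [apply Rdiv_lt_0_compat | apply Rinv_0_lt_compat]; lra).
  split.
  - apply Rle_trans with (2 / PI * / c * (- (2 * c))); [apply Req_le; field; lra|].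
    apply Rmult_le_compat_l; lra.
  - assert (1 <= (PI / 2 / w) ^ 2) by nra.
    apply Ropp_le_cancel. rewrite Ropp_0, Ropp_mult_distr_r. apply Rmult_le_pos; lra. }
assert (0 < 2 / PI) by (apply Rdiv_lt_0_compat; lra).
replace (f k) with (f (1 / 2) + - (f (1 / 2) - f k)) by ring.
eapply Rle_trans; [apply Rabs_triang|]. apply Rplus_le_compat_l. rewrite e.
apply Rabs_le; split; nra.
Qed.

(** * Theta functions and the triple product *)

Lemma pow_01 (r : R) (n : nat) : 0 <= r <= 1 -> 0 <= r ^ n <= 1.
Proof.
intro h; split; [apply pow_le; lra|]. rewrite <- (pow1 n). apply pow_incr; lra.
Qed.

Lemma pow_decr (r : R) (m n : nat) : 0 <= r <= 1 -> (m <= n)%nat -> r ^ n <= r ^ m.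
Proof.
intros h hmn. replace n with (m + (n - m))%nat by lia. rewrite pow_add.
generalize (pow_01 r m h) (pow_01 r (n - m) h). nra.
Qed.

Lemma is_lim_seq_sqr (u : nat -> R) (l : R) : is_lim_seq u l -> is_lim_seq (fun n => u n ^ 2) (l ^ 2).
Proof.
intro h. apply is_lim_seq_ext with (fun n => u n * u n); [intro; ring|].
replace (l ^ 2) with (l * l) by ring. now apply is_lim_seq_mult'.
Qed.

Lemma is_lim_seq_geom_scal (C r : R) : 0 <= r < 1 -> is_lim_seq (fun n => C * r ^ n) 0.
Proof.
intro h. replace (Finite 0) with (Rbar_mult C 0) by (simpl; f_equal; ring).
apply is_lim_seq_scal_l, is_lim_seq_geom. rewrite Rabs_pos_eq; lra.
Qed.

Lemma is_lim_seq_double (u : nat -> R) (l : Rbar) :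
  is_lim_seq u l -> is_lim_seq (fun n => u (2 * n)%nat) l.
Proof.
intro h. apply is_lim_seq_subseq with (2 := h).
intros P [N hN]. exists N. intros n hn. apply hN. lia.
Qed.

(** The rate depends on C and r alone, so for a family in q with common C and r the convergence is
    uniform. The product, the theta series and the continued fraction all pass through this
    estimate. *)
Lemma geom_cauchy (u : nat -> R) (C r : R) : 0 <= r < 1 ->
  (forall n, Rabs (u (S n) - u n) <= C * r ^ n) ->
  is_lim_seq u (real (Lim_seq u)) /\
  forall n, Rabs (real (Lim_seq u) - u n) <= C * r ^ n / (1 - r).
Proof.
intros hr h.
assert (hC : 0 <= C).
{ generalize (h 0%nat) (Rabs_pos (u 1%nat - u 0%nat)). simpl. lra. }
assert (H : forall n m, Rabs (u (n + m)%nat - u n) <= C * r ^ n / (1 - r)).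
{ intros n m. apply Rle_trans with (C * (r ^ n - r ^ (n + m)) / (1 - r)).
  - induction m as [|m IH].
    + rewrite Nat.add_0_r, Rminus_diag, Rabs_R0. apply Req_le; field; lra.
    + rewrite Nat.add_succ_r.
      replace (u (S (n + m)) - u n) with ((u (S (n + m)) - u (n + m)%nat) + (u (n + m)%nat - u n)) by ring.
      eapply Rle_trans; [apply Rabs_triang|].
      eapply Rle_trans; [apply Rplus_le_compat; [apply h | apply IH]|].
      apply Req_le. simpl. field; lra.
  - unfold Rdiv; apply Rmult_le_compat_r; [apply Rlt_le, Rinv_0_lt_compat; lra|].
    apply Rmult_le_compat_l; [lra|]. generalize (pow_01 r (n + m)); lra. }
assert (hcv : ex_finite_lim_seq u).
{ apply ex_lim_seq_cauchy_corr. intro eps.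
  assert (hl := is_lim_seq_geom_scal (C / (1 - r)) r hr).
  apply is_lim_seq_spec in hl. destruct (hl (pos_div_2 eps)) as [N hN].
  exists N. intros n m hn hm.
  assert (hk : forall k, (N <= k)%nat -> Rabs (u k - u N) < eps / 2).
  { intros k hk. replace k with (N + (k - N))%nat by lia.
    eapply Rle_lt_trans; [apply H|]. specialize (hN N (Nat.le_refl N)).
    simpl in hN. rewrite Rminus_0_r in hN.
    eapply Rle_lt_trans; [|apply hN].
    eapply Rle_trans; [|apply Rle_abs]. apply Req_le; field; lra. }
  replace (u n - u m) with ((u n - u N) + - (u m - u N)) by ring.
  eapply Rle_lt_trans; [apply Rabs_triang|]. rewrite Rabs_Ropp.
  generalize (hk n hn) (hk m hm); lra. }
destruct hcv as [l hl]. rewrite (is_lim_seq_unique _ _ hl). simpl real.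
split; [exact hl|]. intro n.
assert (h1 : is_lim_seq (fun m => Rabs (u (m + n)%nat - u n)) (Rabs (l - u n))).
{ apply (is_lim_seq_abs _ (l - u n)). apply is_lim_seq_minus'; [|apply is_lim_seq_const].
  now apply is_lim_seq_incr_n. }
refine (is_lim_seq_le _ _ _ _ _ h1 (is_lim_seq_const _)).
intro m; rewrite Nat.add_comm; apply H.
Qed.

Definition eulerP (q : R) : R := real (Lim_seq (qprod q)).

Lemma qprod_bounds (q : R) (N : nat) : 0 < q < 1 -> 0 < qprod q N <= 1.
Proof.
intro h; induction N as [|N IH]; simpl; [lra|].
assert (0 < q ^ N <= 1). { split; [apply pow_lt; lra | apply pow_01; lra]. }
assert (0 < 1 - q * q ^ N <= 1) by nra.
split; [apply Rmult_lt_0_compat; lra | nra].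
Qed.

Lemma qprod_lim (q r : R) : 0 < q <= r -> r < 1 ->
  is_lim_seq (qprod q) (eulerP q) /\
  forall n, Rabs (eulerP q - qprod q n) <= r * r ^ n / (1 - r).
Proof.
intros h hr. apply (geom_cauchy (qprod q) r r); [lra|].
intro n. simpl. replace (qprod q n * (1 - q * q ^ n) - qprod q n) with (- (qprod q n * (q * q ^ n))) by ring.
rewrite Rabs_Ropp.
destruct (qprod_bounds q n ltac:(lra)).
assert (0 <= q * q ^ n) by (apply Rmult_le_pos; [|apply pow_le]; lra).
rewrite Rabs_pos_eq by (apply Rmult_le_pos; lra).
apply Rle_trans with (q * q ^ n); [nra|].
apply Rmult_le_compat; try apply pow_le; try lra. apply pow_incr; lra.
Qed.

Lemma eulerP_lim (q : R) : 0 < q < 1 -> is_lim_seq (qprod q) (eulerP q).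
Proof. intro h; apply (qprod_lim q q); lra. Qed.

Lemma eulerP_near_1 (q : R) : 0 < q < 1 -> Rabs (eulerP q - 1) <= q / (1 - q).
Proof.
intro h. destruct (qprod_lim q q) as [_ H]; [lra|lra|]. specialize (H 0%nat). simpl in H.
now rewrite Rmult_1_r in H.
Qed.

(** Past some N the remaining exponents have sum of q^n below 1, and a product of factors 1 - x is
    at least 1 minus the sum of the x. *)
Lemma eulerP_pos (q : R) : 0 < q < 1 -> 0 < eulerP q.
Proof.
intro h.
assert (hl := is_lim_seq_geom_scal (q / (1 - q)) q ltac:(lra)).
apply is_lim_seq_spec in hl. destruct (hl (mkposreal _ Rlt_0_1)) as [N hN].
specialize (hN N (Nat.le_refl N)). simpl in hN. rewrite Rminus_0_r in hN.
apply Rle_lt_trans with (1 := Rle_abs _) in hN.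
(* The subtracted term is the sum of q^n over n > N. *)
set (d := 1 - q / (1 - q) * q ^ N) in *.
assert (H : forall m, qprod q N * d <= qprod q (m + N)).
{ intro m. destruct (qprod_bounds q N h).
  apply Rle_trans with (qprod q N * (1 - q / (1 - q) * (q ^ N - q ^ (m + N)))).
  { apply Rmult_le_compat_l; [lra|]. unfold d.
    assert (0 < q / (1 - q)) by (apply Rdiv_lt_0_compat; lra).
    generalize (pow_01 q (m + N)); nra. }
  induction m as [|m IH].
  - simpl. apply Req_le; ring.
  - simpl. destruct (qprod_bounds q (m + N) h) as [h1 h2].
    assert (hp := pow_01 q (m + N) ltac:(lra)).
    apply Rle_trans with (qprod q (m + N) - qprod q N * (q * q ^ (m + N))).
    + apply Rle_trans with (qprod q N * (1 - q / (1 - q) * (q ^ N - q ^ (m + N)))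
        - qprod q N * (q * q ^ (m + N))); [apply Req_le; field; lra | lra].
    + assert (qprod q (m + N) <= qprod q N).
      { clear - h. induction m as [|m IH]; simpl; [lra|].
        destruct (qprod_bounds q (m + N) h). assert (hp := pow_01 q (m + N) ltac:(lra)).
        assert (0 <= q * q ^ (m + N)) by (apply Rmult_le_pos; lra). nra. }
      assert (0 <= q * q ^ (m + N)) by (apply Rmult_le_pos; lra). nra. }
apply Rlt_le_trans with (qprod q N * d).
{ apply Rmult_lt_0_compat; [apply qprod_bounds, h | unfold d; lra]. }
assert (hlim := eulerP_lim q h). apply (is_lim_seq_incr_n _ N) in hlim.
exact (is_lim_seq_le _ _ _ _ H (is_lim_seq_const _) hlim).
Qed.

Fixpoint oprod (z q : R) (N : nat) : R :=
  match N with
  | O => 1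
  | S N' => oprod z q N' * (1 + z * q ^ (2 * N' + 1))
  end.

(* The sum of [f |n|] over [- N <= n <= N]. *)
Fixpoint bisum (f : nat -> R) (N : nat) : R :=
  match N with
  | O => f O
  | S N' => bisum f N' + 2 * f N
  end.

(** Only z = 1 and z = -1 occur; there z^(-n) = z^n, so indexing by |n| gives the bilateral theta
    series. *)
Definition theta_sum (z q : R) : nat -> R := bisum (fun n => z ^ n * q ^ (n * n)).

(* [theta 1 q] and [theta (-1) q] are Jacobi's theta_3 (q) and theta_4 (q). *)
Definition theta (z q : R) : R := real (Lim_seq (theta_sum z q)).

(** The two odd products of the triple product, in z and in 1/z, coincide when z^2 = 1; hence the
    square. *)
Definition theta_prod (z q : R) (N : nat) : R := qprod (q ^ 2) N * oprod z q N ^ 2.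

(* [jtp_coef q N n = qbinomial (2 N) (N + n) (q^2) * q^(n^2)], the coefficient of [z^n] in
   [prod_(1 <= j <= N) (1 + z q^(2j-1)) (1 + z^-1 q^(2j-1))]. *)
Fixpoint jtp_coef (q : R) (N n : nat) : R :=
  match N with
  | O => match n with O => 1 | S _ => 0 end
  | S N' => (1 + q ^ (4 * N' + 2)) * jtp_coef q N' n + q ^ (2 * N' + 1) *
       match n with
       | O => 2 * jtp_coef q N' 1
       | S m => jtp_coef q N' m + jtp_coef q N' (S n)
       end
  end.

Lemma jtp_coef_0 (q : R) (N n : nat) : (N < n)%nat -> jtp_coef q N n = 0.
Proof.
revert n; induction N as [|N IH]; intros [|n] h; try lia; [reflexivity|].
cbn [jtp_coef]. rewrite !IH by lia. ring.
Qed.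

(** Induction on N: the recurrence combines two q-Pascal steps. The boundary indices n = N + 1 and n
    = 0 are separate, the latter because the coefficients of z and 1/z are merged there. *)
Lemma jtp_coef_formula (q : R) (N n : nat) : 0 < q < 1 -> (n <= N)%nat ->
  jtp_coef q N n * (qprod (q ^ 2) (N + n) * qprod (q ^ 2) (N - n)) =
  qprod (q ^ 2) (2 * N) * q ^ (n * n).
Proof.
intro hq. assert (hp : 0 < q ^ 2 < 1) by nra.
revert n; induction N as [|N IH]; intros n h.
{ replace n with 0%nat by lia. simpl. ring. }
assert (pos := fun N => proj1 (qprod_bounds (q ^ 2) N hp)).
assert (pne : forall m, 1 - q ^ 2 * (q ^ 2) ^ m <> 0).
{ intro m. generalize (pow_01 (q ^ 2) m ltac:(lra)). nra. }
assert (IH' : forall n, (n <= N)%nat -> jtp_coef q N n =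
   qprod (q ^ 2) (2 * N) * q ^ (n * n) / (qprod (q ^ 2) (N + n) * qprod (q ^ 2) (N - n))).
{ intros m hm. rewrite <- IH by assumption. field. split; apply Rgt_not_eq, pos. }
replace (2 * S N)%nat with (S (S (2 * N))) by lia.
destruct (Nat.eq_dec n (S N)) as [->|hn].
{ cbn [jtp_coef]. rewrite (jtp_coef_0 q N (S N)), (jtp_coef_0 q N (S (S N))), IH' by lia.
  replace (S N + S N)%nat with (S (S (2 * N))) by lia.
  replace (S N - S N)%nat with O by lia. replace (N - N)%nat with O by lia.
  replace (N + N)%nat with (2 * N)%nat by lia.
  replace (S N * S N)%nat with (N * N + (2 * N + 1))%nat by lia. rewrite (pow_add q (N * N)).
  change (qprod (q ^ 2) 0) with 1. field. apply Rgt_not_eq, pos. }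
destruct n as [|n].
- cbn [jtp_coef]. rewrite Nat.add_0_r, Nat.sub_0_r.
  (* This form of the coefficient also covers N = 0, where the index is out of range and the factor
     1 - (q^2)^N is zero. *)
  assert (e : jtp_coef q N 1 = q * qprod (q ^ 2) (2 * N) * (1 - (q ^ 2) ^ N) /
     (qprod (q ^ 2) N ^ 2 * (1 - q ^ 2 * (q ^ 2) ^ N))).
  { destruct N as [|N].
    - cbn. field. nra.
    - rewrite IH' by lia. replace (S N + 1)%nat with (S (S N)) by lia.
      replace (S N - 1)%nat with N by lia. simpl (1 * 1)%nat. cbn [qprod].
      generalize (pos N) (pne N) (pne (S N)). cbn [pow]. intros. field.
      repeat split; try assumption; lra. }
  rewrite e, IH' by lia. rewrite Nat.add_0_r, Nat.sub_0_r. cbn [qprod].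
  replace (q ^ (4 * N + 2)) with (q ^ 2 * (q ^ 2) ^ N * (q ^ 2) ^ N)
    by (rewrite <- !pow_mult, <- !pow_add; f_equal; lia).
  replace (q ^ (2 * N + 1)) with ((q ^ 2) ^ N * q)
    by (rewrite pow_add, <- pow_mult; f_equal; ring).
  replace ((q ^ 2) ^ (S (2 * N))) with (q ^ 2 * (q ^ 2) ^ N * (q ^ 2) ^ N)
    by (rewrite <- !pow_mult, <- !pow_add; f_equal; lia).
  replace ((q ^ 2) ^ (S (S (2 * N)))) with (q ^ 2 * q ^ 2 * (q ^ 2) ^ N * (q ^ 2) ^ N)
    by (rewrite <- !pow_mult, <- !pow_add; f_equal; lia).
  replace ((q ^ 2) ^ S N) with (q ^ 2 * (q ^ 2) ^ N) by reflexivity.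
  generalize (pne N) (pos N) (pos (2 * N)%nat).
  change (0 * 0)%nat with 0%nat. change (q ^ 0) with 1.
  set (x := (q ^ 2) ^ N). intros. field. split; [|lra].
  intro h0; apply H. rewrite <- h0; ring.
- cbn [jtp_coef].
  (* [w = p^(N-n)], [y = p^n] with [p = q^2]. *)
  remember (N - S n)%nat as d eqn:ed. replace N with (d + S n)%nat in * by lia. clear ed h hn.
  rewrite (IH' (S n)), (IH' n) by lia.
  replace (d + S n - S n)%nat with d by lia. replace (d + S n - n)%nat with (S d) by lia.
  replace (d + S n + S n)%nat with (S (S (d + n + n))) by lia.
  replace (d + S n + n)%nat with (S (d + n + n)) by lia.
  replace (S (d + S n) + S n)%nat with (S (S (S (d + n + n)))) by lia.
  replace (S (d + S n) - S n)%nat with (S d) by lia.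
  (* For d = 0 the index exceeds the range; the factor 1 - (q^2)^d then supplies the value 0. *)
  assert (e : jtp_coef q (d + S n) (S (S n)) =
     qprod (q ^ 2) (2 * (d + S n)) * q ^ (n * n + 4 * n + 4) * (1 - (q ^ 2) ^ d) /
     (qprod (q ^ 2) (S (S (S (d + n + n)))) * qprod (q ^ 2) d)).
  { destruct d as [|d].
    - rewrite jtp_coef_0 by lia. simpl ((q ^ 2) ^ 0). field. split; apply Rgt_not_eq, pos.
    - rewrite IH' by lia.
      replace (S d + S n + S (S n))%nat with (S (S (S (S d + n + n)))) by lia.
      replace (S d + S n - S (S n))%nat with d by lia.
      replace (S (S n) * S (S n))%nat with (n * n + 4 * n + 4)%nat by lia.
      cbn [qprod]. generalize (pos d) (pos (S d + n + n)%nat) (pne d)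
       (pne (S d + n + n)%nat) (pne (S (S d + n + n))%nat) (pne (S (S (S d + n + n)))%nat).
      cbn [pow]. intros. field. repeat split; try assumption; lra. }
  rewrite e. cbn [qprod].
  set (p := q ^ 2) in *. set (w := p ^ d). set (y := p ^ n).
  replace (p ^ S d) with (p * w) by reflexivity.
  assert (ew : forall m, q ^ (2 * m) = p ^ m) by (intro m; unfold p; now rewrite <- pow_mult).
  replace (p ^ S (d + n + n)) with (p * (w * y * y)) by (unfold w, y; rewrite <- !pow_add; reflexivity).
  replace (p ^ S (S (d + n + n))) with (p * p * (w * y * y))
    by (unfold w, y; rewrite <- !pow_add; simpl; ring).
  replace (p ^ S (S (S (d + n + n)))) with (p * p * p * (w * y * y))
    by (unfold w, y; rewrite <- !pow_add; simpl; ring).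
  replace (q ^ (4 * (d + S n) + 2)) with (p * p * p * (w * w * y * y)).
  2:{ replace (4 * (d + S n) + 2)%nat with (2 * (2 * (d + S n) + 1))%nat by lia. rewrite ew.
    unfold w, y. rewrite <- !pow_add. replace (2 * (d + S n) + 1)%nat with (S (S (S (d + d + n + n)))) by lia.
    simpl; ring. }
  replace (p ^ S (2 * (d + S n))) with (p * p * p * (w * w * y * y)).
  2:{ unfold w, y. rewrite <- !pow_add. replace (S (2 * (d + S n)))%nat with (S (S (S (d + d + n + n)))) by lia.
    simpl; ring. }
  replace (p ^ S (S (2 * (d + S n)))) with (p * p * p * p * (w * w * y * y)).
  2:{ unfold w, y. rewrite <- !pow_add. replace (S (S (2 * (d + S n))))%nat with (S (S (S (S (d + d + n + n))))) by lia.
    simpl; ring. }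
  replace (q ^ (2 * (d + S n) + 1)) with (p * w * y * q).
  2:{ rewrite pow_add, ew. unfold w, y. rewrite pow_add; simpl; ring. }
  replace (q ^ (S n * S n)) with (q ^ (n * n) * y * q).
  2:{ replace (S n * S n)%nat with (n * n + 2 * n + 1)%nat by lia. rewrite !pow_add, ew. unfold y; simpl; ring. }
  replace (q ^ (n * n + 4 * n + 4)) with (q ^ (n * n) * y * y * p * p).
  2:{ replace (n * n + 4 * n + 4)%nat with (n * n + (2 * n + (2 * n + (2 * 1 + 2 * 1))))%nat by lia.
    rewrite !pow_add, !ew. unfold y; simpl; ring. }
  assert (hw := pow_01 p d ltac:(lra)). assert (hy := pow_01 p n ltac:(lra)). fold w in hw. fold y in hy.
  assert (hwy : 0 <= w * y * y <= 1). { assert (0 <= w * y <= 1) by nra. nra. }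
  assert (hpp : 0 <= p * (w * y * y) < 1) by nra.
  generalize (pos d) (pos (d + n + n)%nat) (pos (2 * (d + S n))%nat). intros.
  assert (n1 : 1 - p * w <> 0) by nra.
  assert (n2 : 1 - p * (w * y * y) <> 0) by nra.
  assert (n3 : 1 - p * p * (w * y * y) <> 0) by nra.
  assert (n4 : 1 - p * p * p * (w * y * y) <> 0) by nra.
  assert (hp2 : p = q * q) by (unfold p; ring).
  field_simplify_eq; [|repeat split; try lra].
  rewrite hp2. ring.
Qed.

Lemma Rdiv_mult_cancel (x y : R) : y <> 0 -> x / y * y = x.
Proof. intro; field; assumption. Qed.

Lemma sq_m1 : (-1) ^ 2 = 1.
Proof. simpl; lra. Qed.

Lemma bisum_ext (f g : nat -> R) (N : nat) :
  (forall n, (n <= N)%nat -> f n = g n) -> bisum f N = bisum g N.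
Proof.
induction N as [|N IH]; intro h; simpl; [apply h; lia|].
rewrite IH by (intros; apply h; lia). now rewrite h by lia.
Qed.

Lemma bisum_scal (c : R) (f : nat -> R) (N : nat) : bisum (fun n => c * f n) N = c * bisum f N.
Proof. induction N as [|N IH]; simpl; [|rewrite IH]; ring. Qed.

Lemma bisum_dist (f g : nat -> R) (e : R) (N : nat) :
  (forall n, (n <= N)%nat -> Rabs (f n - g n) <= e) ->
  Rabs (bisum f N - bisum g N) <= (2 * INR N + 1) * e.
Proof.
induction N as [|N IH]; intro h.
- simpl. rewrite Rmult_0_r, Rplus_0_l, Rmult_1_l. apply h; lia.
- rewrite S_INR. cbn [bisum].
  replace (bisum f N + 2 * f (S N) - (bisum g N + 2 * g (S N)))
    with ((bisum f N - bisum g N) + 2 * (f (S N) - g (S N))) by ring.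
  eapply Rle_trans; [apply Rabs_triang|].
  rewrite Rabs_mult, (Rabs_pos_eq 2) by lra.
  specialize (IH (fun n hn => h n (Nat.le_trans _ _ _ hn (Nat.le_succ_diag_r N)))).
  specialize (h (S N) (Nat.le_refl _)). lra.
Qed.

Lemma jtp_finite (z q : R) (N : nat) : z ^ 2 = 1 ->
  bisum (fun n => z ^ n * jtp_coef q N n) N = oprod z q N ^ 2.
Proof.
intro hz. induction N as [|N IH]; [simpl; ring|].
set (g := fun n => z ^ n * jtp_coef q N n) in *.
(* Multiplication by z and 1/z shifts indices, so a truncated sum leaves the boundary terms g (M +
   1) - g M. They vanish at M = N + 1, beyond the support of g. *)
assert (H : forall M, bisum (fun n => z ^ n * jtp_coef q (S N) n) M =
   (1 + q ^ (4 * N + 2)) * bisum g M + q ^ (2 * N + 1) * (2 * z * (bisum g M + g (S M) - g M))).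
{ induction M as [|M IHM].
  - cbn [bisum jtp_coef]. unfold g. simpl (z ^ _).
    transitivity ((1 + q ^ (4 * N + 2)) * jtp_coef q N 0 + q ^ (2 * N + 1) * (2 * z ^ 2 * jtp_coef q N 1));
    [rewrite hz|]; ring.
  - cbn [bisum]. rewrite IHM. unfold g. cbn [jtp_coef pow].
    set (A := bisum _ M).
    apply Rminus_diag_uniq.
    transitivity (2 * z * z ^ M * q ^ (2 * N + 1) * (1 - z ^ 2) * jtp_coef q N (S (S M)));
    [|rewrite hz]; ring. }
rewrite H. cbn [bisum].
replace (g (S (S N))) with 0 by (unfold g; rewrite jtp_coef_0 by lia; ring).
replace (g (S N)) with 0 by (unfold g; rewrite jtp_coef_0 by lia; ring).
rewrite Rmult_0_r, !Rplus_0_r, Rminus_0_r, IH. cbn [oprod].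
replace (q ^ (4 * N + 2)) with (q ^ (2 * N + 1) * q ^ (2 * N + 1)) by (rewrite <- pow_add; f_equal; lia).
set (x := q ^ (2 * N + 1)). set (o := oprod z q N).
transitivity (o ^ 2 * (1 + 2 * z * x + z ^ 2 * x ^ 2)); [rewrite hz|]; ring.
Qed.

(** The normalised coefficient with q^(n^2) removed; it tends to 1 for fixed n as N grows. *)
Definition jtp_ratio (p : R) (N n : nat) : R :=
  qprod p N ^ 2 / (qprod p (N + n) * qprod p (N - n)).

(** Going from n to n + 1 multiplies the ratio by (1 - p^(N-n)) / (1 - p^(N+n+1)), a loss of at most
    p^(N-n); the losses form a geometric sum. *)
Lemma jtp_ratio_bounds (p : R) (N n : nat) : 0 < p < 1 -> (n <= N)%nat ->
  1 - p ^ (N - n) / (1 - p) <= jtp_ratio p N n <= 1.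
Proof.
intros hp; assert (pos := fun N => proj1 (qprod_bounds p N hp)).
induction n as [|n IH]; intro h.
- replace (jtp_ratio p N 0) with 1.
  + assert (0 <= p ^ (N - 0) / (1 - p)); [|lra].
    unfold Rdiv; apply Rmult_le_pos; [apply pow_le; lra | apply Rlt_le, Rinv_0_lt_compat; lra].
  + unfold jtp_ratio. rewrite Nat.add_0_r, Nat.sub_0_r. field. apply Rgt_not_eq, pos.
- specialize (IH ltac:(lia)).
  remember (N - S n)%nat as d eqn:ed. replace (N - n)%nat with (S d) in IH by lia.
  assert (e : jtp_ratio p N (S n) = jtp_ratio p N n * (1 - p ^ S d) / (1 - p ^ (S (N + n)))).
  { unfold jtp_ratio. rewrite <- ed. replace (N - n)%nat with (S d) by lia. rewrite Nat.add_succ_r.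
    cbn [qprod]. generalize (pow_01 p d ltac:(lra)) (pow_01 p (N + n) ltac:(lra)); intros.
    simpl pow. field. repeat split; try (apply Rgt_not_eq, pos); nra. }
  assert (0 < jtp_ratio p N n).
  { unfold jtp_ratio. apply Rdiv_lt_0_compat; [apply pow_lt | apply Rmult_lt_0_compat]; apply pos. }
  assert (hx := pow_01 p d ltac:(lra)).
  assert (hy : 0 <= p ^ S (N + n) <= p ^ S d).
  { split; [apply pow_le; lra | apply pow_decr; [lra|lia]]. }
  assert (hd : p ^ S d < 1) by (simpl; nra).
  assert (hd0 : 0 <= p ^ S d) by (apply pow_le; lra).
  assert (hu : jtp_ratio p N n * (1 - p ^ S d) <= jtp_ratio p N (S n) <= jtp_ratio p N n).
  { set (t := jtp_ratio p N n) in *. rewrite e. set (s := p ^ S (N + n)) in *. split.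
    - apply (Rmult_le_reg_r (1 - s)); [lra|]. rewrite Rdiv_mult_cancel by lra.
      assert (0 <= t * (1 - p ^ S d)) by (apply Rmult_le_pos; lra). nra.
    - apply (Rmult_le_reg_r (1 - s)); [lra|]. rewrite Rdiv_mult_cancel by lra. nra. }
  split; [|lra].
  apply Rle_trans with (1 - p ^ S d / (1 - p) - p ^ S d).
  + assert (p ^ d / (1 - p) = p ^ S d / (1 - p) + p ^ d) by (simpl; field; lra).
    simpl in *; nra.
  + nra.
Qed.

Lemma jtp_coef_ratio (q : R) (N n : nat) : 0 < q < 1 -> (n <= N)%nat ->
  jtp_coef q N n * (qprod (q ^ 2) N ^ 2 / qprod (q ^ 2) (2 * N)) = q ^ (n * n) * jtp_ratio (q ^ 2) N n.
Proof.
intros hq h. assert (hp : 0 < q ^ 2 < 1) by nra.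
assert (pos := fun N => Rgt_not_eq _ _ (proj1 (qprod_bounds (q ^ 2) N hp))).
assert (H := jtp_coef_formula q N n hq h).
unfold jtp_ratio.
apply (Rmult_eq_reg_r (qprod (q ^ 2) (N + n) * qprod (q ^ 2) (N - n))).
2:{ apply Rmult_integral_contrapositive; split; apply pos. }
transitivity (jtp_coef q N n * (qprod (q ^ 2) (N + n) * qprod (q ^ 2) (N - n)) *
   (qprod (q ^ 2) N ^ 2 / qprod (q ^ 2) (2 * N))); [ring|].
rewrite H. field. repeat split; apply pos.
Qed.

(** With s = sqrt r, Bernoulli's inequality for 1/s bounds n s^n, and the other factor s^n still
    tends to 0. *)
Lemma is_lim_seq_INR_geom (r : R) : 0 < r < 1 -> is_lim_seq (fun n => (2 * INR n + 1) * r ^ n) 0.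
Proof.
intro h. set (s := sqrt r).
assert (hs0 : 0 < s) by (apply sqrt_lt_R0; lra).
assert (hs2 : s ^ 2 = r) by (apply pow2_sqrt; lra).
assert (hs : s < 1) by nra.
apply is_lim_seq_le_le with (fun _ => 0) (fun n => (2 / (/ s - 1) + 1) * s ^ n).
- intro n. split.
  { apply Rmult_le_pos; [generalize (pos_INR n); lra | apply pow_le; lra]. }
  rewrite <- hs2, <- pow_mult, Nat.mul_comm.
  replace (n * 2)%nat with (n + n)%nat by lia. rewrite pow_add, <- Rmult_assoc.
  apply Rmult_le_compat_r; [apply pow_le; lra|].
  assert (h1 : 0 < / s - 1).
  { apply Rlt_0_minus. rewrite <- Rinv_1. apply Rinv_lt_contravar; lra. }
  assert (hb := poly n (/ s - 1) h1). replace (1 + (/ s - 1)) with (/ s) in hb by ring.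
  rewrite pow_inv in hb.
  assert (hsn : 0 < s ^ n) by (apply pow_lt; lra).
  apply (Rmult_le_compat_r (s ^ n)) in hb; [|lra]. rewrite Rinv_l in hb by lra.
  assert (h2 := pow_01 s n ltac:(lra)).
  assert (INR n * s ^ n <= / (/ s - 1)).
  { apply (Rmult_le_reg_r (/ s - 1)); [lra|]. rewrite Rinv_l by lra. lra. }
  unfold Rdiv; lra.
- apply is_lim_seq_const.
- apply is_lim_seq_geom_scal; lra.
Qed.

Lemma sq_1_cases (z : R) : z ^ 2 = 1 -> z = 1 \/ z = -1.
Proof.
intro h. assert (e : (z - 1) * (z + 1) = 0) by (ring_simplify; lra).
apply Rmult_integral in e; destruct e; [left | right]; lra.
Qed.

Lemma Rabs_pow_1 (z : R) (n : nat) : z ^ 2 = 1 -> Rabs (z ^ n) = 1.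
Proof.
intro h. rewrite <- RPow_abs.
replace (Rabs z) with 1; [apply pow1|].
destruct (sq_1_cases z h); subst; [rewrite Rabs_pos_eq | rewrite Rabs_left]; lra.
Qed.

Lemma theta_lim_aux (z q : R) : z ^ 2 = 1 -> 0 < q < 1 ->
  is_lim_seq (theta_sum z q) (theta z q) /\ Rabs (theta z q - 1) <= 2 * q / (1 - q).
Proof.
intros hz hq.
destruct (geom_cauchy (theta_sum z q) (2 * q) q) as [h1 h2]; [lra| |].
- intro n. unfold theta_sum. cbn [bisum]. set (A := bisum _ n).
  replace (A + 2 * (z ^ S n * q ^ (S n * S n)) - A) with (z ^ S n * (2 * q ^ (S n * S n))) by ring.
  rewrite Rabs_mult, Rabs_pow_1, Rmult_1_l by assumption.
  rewrite Rabs_pos_eq by (apply Rmult_le_pos; [lra|apply pow_le; lra]).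
  rewrite Rmult_assoc. apply Rmult_le_compat_l; [lra|].
  change (q * q ^ n) with (q ^ S n). apply pow_decr; [lra|nia].
- split; [exact h1|]. specialize (h2 0%nat). unfold theta_sum in h2 at 2. simpl in h2.
  rewrite !Rmult_1_r in h2. exact h2.
Qed.

Lemma theta_lim (z q : R) : z ^ 2 = 1 -> 0 < q < 1 -> is_lim_seq (theta_sum z q) (theta z q).
Proof. intros; now apply theta_lim_aux. Qed.

Lemma theta_near_1 (z q : R) : z ^ 2 = 1 -> 0 < q < 1 -> Rabs (theta z q - 1) <= 2 * q / (1 - q).
Proof. intros; now apply theta_lim_aux. Qed.

(** The triple product. In place of dominated convergence, each normalised term differs from z^n
    q^(n^2) by at most q^N / (1 - q^2), and 2 N + 1 such errors tend to 0. *)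
Lemma theta_prod_lim (z q : R) : z ^ 2 = 1 -> 0 < q < 1 ->
  is_lim_seq (theta_prod z q) (theta z q).
Proof.
intros hz hq. assert (hp : 0 < q ^ 2 < 1) by nra.
assert (hP := eulerP_pos (q ^ 2) hp). assert (hl := eulerP_lim (q ^ 2) hp).
assert (pos := fun N => Rgt_not_eq _ _ (proj1 (qprod_bounds (q ^ 2) N hp))).
set (u := fun N => bisum (fun n => z ^ n * (q ^ (n * n) * jtp_ratio (q ^ 2) N n)) N).
assert (hu : is_lim_seq u (theta z q)).
{ apply is_lim_seq_ext with (fun N => theta_sum z q N - (theta_sum z q N - u N)); [intro; ring|].
  replace (theta z q) with (theta z q - 0) by ring.
  apply is_lim_seq_minus'; [now apply theta_lim|].
  apply is_lim_seq_abs_0.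
  apply is_lim_seq_le_le with (fun _ => 0) (fun N => / (1 - q ^ 2) * ((2 * INR N + 1) * q ^ N)).
  - intro N; split; [apply Rabs_pos|]. unfold u, theta_sum.
    replace (/ (1 - q ^ 2) * ((2 * INR N + 1) * q ^ N))
      with ((2 * INR N + 1) * (q ^ N / (1 - q ^ 2))) by (unfold Rdiv; ring).
    apply bisum_dist. intros n hn. rewrite <- Rmult_minus_distr_l, Rabs_mult, Rabs_pow_1, Rmult_1_l by assumption.
    assert (hb := jtp_ratio_bounds (q ^ 2) N n hp hn).
    assert (h0 := pow_01 q (n * n) ltac:(lra)).
    replace (q ^ (n * n) - q ^ (n * n) * jtp_ratio (q ^ 2) N n)
      with (q ^ (n * n) * (1 - jtp_ratio (q ^ 2) N n)) by ring.
    rewrite Rabs_pos_eq by (apply Rmult_le_pos; lra).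
    apply Rle_trans with (q ^ (n * n) * ((q ^ 2) ^ (N - n) / (1 - q ^ 2))).
    { apply Rmult_le_compat_l; lra. }
    unfold Rdiv. rewrite <- Rmult_assoc. apply Rmult_le_compat_r; [apply Rlt_le, Rinv_0_lt_compat; lra|].
    rewrite <- pow_mult, <- pow_add. apply pow_decr; [lra|].
    (* The exponent inequality is N <= n^2 + 2 (N - n) for n <= N; only n = 1 has n^2 < 2 n, and
       there N >= 1. *)
    destruct n as [|[|n]]; nia.
  - apply is_lim_seq_const.
  - replace (Finite 0) with (Rbar_mult (/ (1 - q ^ 2)) 0) by (simpl; f_equal; ring).
    apply is_lim_seq_scal_l, is_lim_seq_INR_geom, hq. }
apply is_lim_seq_ext with (fun N => u N * (qprod (q ^ 2) (2 * N) / qprod (q ^ 2) N)).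
- intro N. unfold u, theta_prod. rewrite <- (jtp_finite z q N hz).
  rewrite (bisum_ext _ (fun n => (qprod (q ^ 2) N ^ 2 / qprod (q ^ 2) (2 * N)) * (z ^ n * jtp_coef q N n))).
  + rewrite bisum_scal. field. split; apply pos.
  + intros n hn. rewrite <- jtp_coef_ratio by assumption. ring.
- replace (theta z q) with (theta z q * (eulerP (q ^ 2) / eulerP (q ^ 2))) by (field; lra).
  apply is_lim_seq_mult'; [exact hu|]. apply is_lim_seq_div'; [|exact hl|lra].
  now apply is_lim_seq_double.
Qed.

Lemma qprod_double (q : R) (N : nat) : qprod q (2 * N) = qprod (q ^ 2) N * oprod (-1) q N.
Proof.
induction N as [|N IH]; [simpl; ring|].
replace (2 * S N)%nat with (S (S (2 * N))) by lia. cbn [qprod oprod]. rewrite IH.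
replace (2 * N + 1)%nat with (S (2 * N)) by lia.
replace ((q ^ 2) ^ S N) with (q ^ S (S (2 * N))) by (rewrite <- pow_mult; f_equal; lia).
ring.
Qed.

Lemma oprod_mul_opp (q : R) (N : nat) : oprod 1 q N * oprod (-1) q N = oprod (-1) (q ^ 2) N.
Proof.
induction N as [|N IH]; [simpl; ring|]. cbn [oprod]. rewrite <- IH, <- pow_mult.
replace (2 * (2 * N + 1))%nat with ((2 * N + 1) + (2 * N + 1))%nat by lia.
rewrite (pow_add q (2 * N + 1)); ring.
Qed.

(** Splitting the Euler product at q into even and odd factors shows that the odd product is eulerP
    q / eulerP (q^2); the triple product contains its square. *)
Lemma theta4_eulerP (q : R) : 0 < q < 1 -> theta (-1) q * eulerP (q ^ 2) = eulerP q ^ 2.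
Proof.
intro hq. assert (hp : 0 < q ^ 2 < 1) by nra.
enough (E : Finite (theta (-1) q * eulerP (q ^ 2)) = Finite (eulerP q ^ 2)) by (now injection E).
assert (h1 := is_lim_seq_mult' _ _ _ _ (theta_prod_lim (-1) q sq_m1 hq) (eulerP_lim _ hp)).
assert (h2 := is_lim_seq_sqr _ _ (is_lim_seq_double _ _ (eulerP_lim q hq))).
rewrite <- (is_lim_seq_unique _ _ h1), <- (is_lim_seq_unique _ _ h2).
apply Lim_seq_ext. intro N. rewrite qprod_double. unfold theta_prod. ring.
Qed.

Lemma theta3_theta4 (q : R) : 0 < q < 1 -> theta 1 q * theta (-1) q = theta (-1) (q ^ 2) ^ 2.
Proof.
intro hq. assert (hp : 0 < q ^ 2 < 1) by nra.
assert (hP := eulerP_pos _ hp). assert (hl := eulerP_lim _ hp).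
assert (pos := fun N => Rgt_not_eq _ _ (proj1 (qprod_bounds (q ^ 2) N hp))).
(* The extra factor (qprod (2N) / qprod N)^2 tends to 1 and makes the two partial products equal at
   every N, not only in the limit. *)
assert (h1 := is_lim_seq_mult' _ _ _ _
  (is_lim_seq_mult' _ _ _ _ (theta_prod_lim 1 q (pow1 2) hq) (theta_prod_lim (-1) q sq_m1 hq))
  (is_lim_seq_sqr _ _ (is_lim_seq_div' _ _ _ _ (is_lim_seq_double _ _ hl) hl ltac:(lra)))).
assert (h2 := is_lim_seq_sqr _ _ (theta_prod_lim (-1) (q ^ 2) sq_m1 hp)).
replace (theta 1 q * theta (-1) q * (eulerP (q ^ 2) / eulerP (q ^ 2)) ^ 2)
   with (theta 1 q * theta (-1) q) in h1 by (field; lra).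
enough (E : Finite (theta 1 q * theta (-1) q) = Finite (theta (-1) (q ^ 2) ^ 2)) by (now injection E).
rewrite <- (is_lim_seq_unique _ _ h1), <- (is_lim_seq_unique _ _ h2).
apply Lim_seq_ext. intro N. rewrite qprod_double. unfold theta_prod. rewrite <- oprod_mul_opp.
field. apply pos.
Qed.

(** Odd terms cancel, and an even index 2 n contributes q^(4 n^2). *)
Lemma theta_add (q : R) : 0 < q < 1 -> theta 1 q + theta (-1) q = 2 * theta 1 (q ^ 4).
Proof.
intro hq. assert (hp : 0 < q ^ 4 < 1).
{ split; [apply pow_lt; lra|]. apply Rle_lt_trans with (q ^ 1); [apply pow_decr; [lra|lia]|lra]. }
assert (h1 := is_lim_seq_plus' _ _ _ _ (is_lim_seq_double _ _ (theta_lim 1 q (pow1 2) hq))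
   (is_lim_seq_double _ _ (theta_lim (-1) q sq_m1 hq))).
assert (h2 := is_lim_seq_mult' _ _ _ _ (is_lim_seq_const 2) (theta_lim 1 (q ^ 4) (pow1 2) hp)).
enough (E : Finite (theta 1 q + theta (-1) q) = Finite (2 * theta 1 (q ^ 4))) by (now injection E).
rewrite <- (is_lim_seq_unique _ _ h1), <- (is_lim_seq_unique _ _ h2).
apply Lim_seq_ext. unfold theta_sum. induction n as [|n IH]; [simpl; ring|].
replace (2 * S n)%nat with (S (S (2 * n))) by lia. cbn [bisum].
replace (q ^ (S (S (2 * n)) * S (S (2 * n)))) with ((q ^ 4) ^ (S n * S n))
  by (rewrite <- pow_mult; f_equal; lia).
rewrite !pow1.
replace ((-1) ^ S (S (2 * n))) with 1 by (rewrite <- !tech_pow_Rmult, pow_1_even; ring).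
replace ((-1) ^ S (2 * n)) with (-1) by (rewrite <- !tech_pow_Rmult, pow_1_even; ring).
lra.
Qed.

Lemma theta4_pos (q : R) : 0 < q < 1 -> 0 < theta (-1) q.
Proof.
intro hq. assert (hp : 0 < q ^ 2 < 1) by nra.
assert (h := theta4_eulerP q hq). assert (h1 := eulerP_pos q hq). assert (h2 := eulerP_pos _ hp).
assert (0 < eulerP q ^ 2) by (apply pow_lt; lra). nra.
Qed.

(** Every term of the difference is nonnegative, and n = 1 and n = -1 together contribute 4 q; the
    sequence is therefore shifted to start at N = 1. *)
Lemma theta3_sub_theta4 (q : R) : 0 < q < 1 -> 4 * q <= theta 1 q - theta (-1) q.
Proof.
intro hq.
assert (h := is_lim_seq_minus' _ _ _ _ (theta_lim 1 q (pow1 2) hq) (theta_lim (-1) q sq_m1 hq)).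
apply (is_lim_seq_incr_n _ 1) in h.
refine (is_lim_seq_le _ _ _ _ _ (is_lim_seq_const (4 * q)) h).
intro n. unfold theta_sum. rewrite Nat.add_1_r. induction n as [|n IH]; [simpl; lra|].
eapply Rle_trans; [exact IH|]. set (m := S n). cbn [bisum].
assert (0 <= (1 - (-1) ^ S m) * q ^ (S m * S m)); [|rewrite pow1; lra].
apply Rmult_le_pos; [|apply pow_le; lra].
generalize (Rle_abs ((-1) ^ S m)). rewrite pow_1_abs. lra.
Qed.

(** * The modulus as a function of the nome *)

(** Repeated squaring brings any q in (0, 1) below r, and the implication carries the property
    back. *)
Lemma square_descent (Q : R -> Prop) (r : R) : 0 < r ->
  (forall q, 0 < q <= r -> Q q) ->
  (forall q, 0 < q < 1 -> Q (q ^ 2) -> Q q) ->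
  forall q, 0 < q < 1 -> Q q.
Proof.
intros hr h0 h1.
assert (H : forall n q, 0 < q < 1 -> q ^ (2 ^ n) <= r -> Q q).
{ induction n as [|n IH]; intros q hq h.
  - apply h0. rewrite Nat.pow_0_r, pow_1 in h. lra.
  - apply h1; [exact hq|]. apply IH; [nra|]. rewrite <- pow_mult. exact h. }
intros q hq.
destruct (pow_lt_1_zero q) with (y := r) as [N hN]; [rewrite Rabs_pos_eq; lra | exact hr|].
apply (H N q hq). apply Rlt_le, Rle_lt_trans with (1 := Rle_abs _). apply hN.
apply Nat.lt_le_incl, Nat.pow_gt_lin_r; lia.
Qed.

Lemma contraction_vanish (w : R -> R) (r C : R) : 0 < r < 1 ->
  (forall q, 0 < q <= r -> Rabs (w q) <= C) ->
  (forall q, 0 < q <= r -> Rabs (w q) <= / 2 * Rabs (w (q ^ 2))) ->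
  forall q, 0 < q <= r -> w q = 0.
Proof.
intros hr hb hw.
assert (H : forall n q, 0 < q <= r -> Rabs (w q) <= C * (/ 2) ^ n).
{ induction n as [|n IH]; intros q hq; [rewrite Rmult_1_r; auto|].
  assert (h := hw q hq). assert (h' := IH (q ^ 2) ltac:(nra)). simpl; lra. }
intros q hq.
assert (h : Rbar_le (Rabs (w q)) 0).
{ refine (is_lim_seq_le _ _ _ _ (fun n => H n q hq) (is_lim_seq_const _) _).
  apply is_lim_seq_geom_scal; lra. }
simpl in h. destruct (Req_dec (w q) 0) as [e|e]; [exact e|].
apply Rabs_pos_lt in e. lra.
Qed.

Lemma doubling_vanish (f : R -> R) (r C : R) : 0 < r < 1 ->
  (forall q, 0 < q <= r -> Rabs (f q) <= C) ->
  (forall q, 0 < q < 1 -> f (q ^ 2) = 2 * f q) ->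
  forall q, 0 < q < 1 -> f q = 0.
Proof.
intros hr hb hf. apply (square_descent _ r); [lra| |].
- apply (contraction_vanish f r C hr hb).
  intros q hq. rewrite hf, Rabs_mult, (Rabs_pos_eq 2) by lra. lra.
- intros q hq h. rewrite hf in h by assumption. lra.
Qed.

(** For u(q) / q the factor becomes s q, at most 1/2 in absolute value when q <= 1/4: linear decay
    turns even an expanding relation into a contraction. *)
Lemma square_invariant_vanish (u : R -> R) (s r C : R) : 0 < r <= / 4 -> Rabs s <= 2 ->
  (forall q, 0 < q <= r -> Rabs (u q) <= C * q) ->
  (forall q, 0 < q < 1 -> u q = s * u (q ^ 2)) ->
  forall q, 0 < q < 1 -> u q = 0.
Proof.
intros hr hs hb hu. apply (square_descent _ r); [lra| |].
- intros q hq.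
  assert (h : u q / q = 0).
  { apply (contraction_vanish (fun q => u q / q) r C); [lra| | |exact hq].
    - intros x hx. rewrite Rabs_div by lra. rewrite (Rabs_pos_eq x) by lra.
      apply (Rmult_le_reg_r x); [lra|]. rewrite Rdiv_mult_cancel by lra. auto.
    - intros x hx. rewrite hu by lra.
      replace (s * u (x ^ 2) / x) with (s * x * (u (x ^ 2) / x ^ 2)) by (field; lra).
      rewrite Rabs_mult. apply Rmult_le_compat_r; [apply Rabs_pos|].
      rewrite Rabs_mult, (Rabs_pos_eq x) by lra.
      generalize (Rabs_pos s); nra. }
  replace (u q) with (u q / q * q) by (apply Rdiv_mult_cancel; lra). rewrite h; ring.
- intros q hq h. rewrite hu, h by assumption; ring.
Qed.

Lemma theta_near (z q : R) : z ^ 2 = 1 -> 0 < q <= / 4 -> 1 - 3 * q <= theta z q <= 1 + 3 * q.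
Proof.
intros hz hq. assert (h := theta_near_1 z q hz ltac:(lra)).
assert (2 * q / (1 - q) <= 3 * q).
{ apply (Rmult_le_reg_r (1 - q)); [lra|]. rewrite Rdiv_mult_cancel by lra. nra. }
apply Rabs_le_between in h. lra.
Qed.

Lemma theta_sq_near (z q : R) : z ^ 2 = 1 -> 0 < q <= / 4 ->
  1 - 9 * q <= theta z q ^ 2 <= 1 + 9 * q.
Proof. intros hz hq. assert (h := theta_near z q hz hq). nra. Qed.

(** With A, B the values theta_3, theta_4 at q, substituting theta_4(q^2)^2 = A B and theta_3(q^4) =
    (A + B)/2 into the defect at q^2 gives minus half the defect at q. The constant 36 is 9 + 9 + 2
    * 9. *)
Lemma theta_sq_add (q : R) : 0 < q < 1 ->
  theta 1 q ^ 2 + theta (-1) q ^ 2 = 2 * theta 1 (q ^ 2) ^ 2.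
Proof.
intro hq. apply Rminus_diag_uniq. revert q hq.
apply (square_invariant_vanish (fun q => theta 1 q ^ 2 + theta (-1) q ^ 2 - 2 * theta 1 (q ^ 2) ^ 2)
   (-2) (/ 4) 36); [lra | rewrite Rabs_left; lra | |].
- intros q hq. assert (h1 := theta_sq_near 1 q (pow1 2) hq). assert (h2 := theta_sq_near (-1) q sq_m1 hq).
  assert (h3 := theta_sq_near 1 (q ^ 2) (pow1 2) ltac:(nra)).
  assert (q ^ 2 <= q) by nra.
  apply Rabs_le; lra.
- intros q hq. assert (h1 := theta_add q hq). assert (h2 := theta3_theta4 q hq).
  rewrite <- pow_mult. change (2 * 2)%nat with 4%nat.
  set (D := theta 1 (q ^ 4)) in *. set (E := theta 1 (q ^ 2)) in *.
  set (F := theta (-1) (q ^ 2)) in *. set (A := theta 1 q) in *. set (B := theta (-1) q) in *.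
  rewrite <- h2. replace (D ^ 2) with (((A + B) / 2) ^ 2) by (rewrite h1; field). field.
Qed.

Lemma sq_01 (q : R) : 0 < q < 1 -> 0 < q ^ 2 < 1.
Proof. intro; nra. Qed.

Definition agm_a (q : R) : R := theta 1 q ^ 2.
Definition agm_b (q : R) : R := theta (-1) q ^ 2.
Definition modulus (q : R) : R := kcomp (agm_b q / agm_a q).

Lemma agm_ab_lt (q : R) : 0 < q < 1 -> 0 < agm_b q < agm_a q.
Proof.
intro hq. assert (h1 := theta4_pos q hq). assert (h2 := theta3_sub_theta4 q hq).
unfold agm_a, agm_b. split; [apply pow_lt, h1 | nra].
Qed.

Lemma agm_a_sq (q : R) : 0 < q < 1 -> agm_a (q ^ 2) = (agm_a q + agm_b q) / 2.
Proof. intro hq. unfold agm_a, agm_b. rewrite theta_sq_add by assumption. field. Qed.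

Lemma agm_b_sq (q : R) : 0 < q < 1 -> agm_b (q ^ 2) = sqrt (agm_a q * agm_b q).
Proof.
intro hq. assert (h1 := theta4_pos q hq). assert (h2 := theta3_sub_theta4 q hq).
unfold agm_a, agm_b. rewrite <- theta3_theta4, <- Rpow_mult_distr by assumption.
symmetry; apply sqrt_pow2. apply Rmult_le_pos; lra.
Qed.

Lemma agm_ratio_01 (q : R) : 0 < q < 1 -> 0 < agm_b q / agm_a q < 1.
Proof.
intro hq. assert (h := agm_ab_lt q hq). split; [apply Rdiv_lt_0_compat; lra|].
apply (Rmult_lt_reg_r (agm_a q)); [lra|]. rewrite Rdiv_mult_cancel; lra.
Qed.

Lemma modulus_01 (q : R) : 0 < q < 1 -> 0 < modulus q < 1.
Proof. intro hq. now apply kcomp_bounds, agm_ratio_01. Qed.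

Lemma modulus_sq (q : R) : 0 < q < 1 -> modulus q ^ 2 = 1 - (agm_b q / agm_a q) ^ 2.
Proof. intro hq; now apply kcomp_sq, agm_ratio_01. Qed.

Lemma agm_near (q : R) : 0 < q <= / 400 ->
  1 - 9 * q <= agm_a q <= 1 + 9 * q /\ 1 - 9 * q <= agm_b q <= 1 + 9 * q.
Proof.
intro hq. split; apply theta_sq_near; lra.
Qed.

Lemma agm_diff_bounds (q : R) : 0 < q <= / 400 -> 4 * q <= agm_a q ^ 2 - agm_b q ^ 2 <= 54 * q.
Proof.
intro hq. destruct (agm_near q hq) as [h1 h2].
assert (h3 := theta3_sub_theta4 q ltac:(lra)).
assert (h4 := theta_near 1 q (pow1 2) ltac:(lra)).
assert (h5 := theta_near (-1) q sq_m1 ltac:(lra)).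
replace (agm_a q ^ 2 - agm_b q ^ 2)
  with ((theta 1 q - theta (-1) q) * ((theta 1 q + theta (-1) q) * (agm_a q + agm_b q)))
  by (unfold agm_a, agm_b; ring).
assert (1 <= (theta 1 q + theta (-1) q) * (agm_a q + agm_b q) <= 9) by nra.
nra.
Qed.

(** The integral is unchanged by q -> q^2 and within O(q) of its value PI/2 at (1, 1). *)
Lemma gauss_int_theta (q : R) : 0 < q < 1 -> gauss_int (agm_a q) (agm_b q) = PI / 2.
Proof.
intro hq. apply Rminus_diag_uniq. revert q hq.
assert (hpi := PI_RGT_0).
apply (square_invariant_vanish (fun q => gauss_int (agm_a q) (agm_b q) - PI / 2) 1 (/ 400) (9 * PI));
  [lra | rewrite Rabs_pos_eq; lra | |].
- intros q hq. destruct (agm_near q hq) as [h1 h2]. assert (h := agm_ab_lt q ltac:(lra)).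
  assert (hg := gauss_int_bounds (agm_a q) (agm_b q) ltac:(lra)).
  assert (PI / 2 / agm_b q <= PI / 2 * (1 + 18 * q)).
  { apply (Rmult_le_reg_r (agm_b q)); [lra|]. rewrite Rdiv_mult_cancel, Rmult_assoc by lra.
    assert (1 <= (1 + 18 * q) * agm_b q) by nra. nra. }
  assert (PI / 2 * (1 - 9 * q) <= PI / 2 / agm_a q).
  { apply (Rmult_le_reg_r (agm_a q)); [lra|]. rewrite Rdiv_mult_cancel, Rmult_assoc by lra.
    assert ((1 - 9 * q) * agm_a q <= 1) by nra. nra. }
  apply Rabs_le; nra.
- intros q hq. rewrite Rmult_1_l, agm_a_sq, agm_b_sq by assumption.
  rewrite <- gauss_int_agm by (apply agm_ab_lt in hq; lra). reflexivity.
Qed.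

Lemma ellK_modulus (q : R) : 0 < q < 1 -> ellK (modulus q) = PI / 2 * agm_a q.
Proof.
intro hq. unfold modulus. rewrite ellK_gauss_div by now apply agm_ab_lt.
rewrite gauss_int_theta by assumption. ring.
Qed.

Lemma modulus_sq_bounds (q : R) : 0 < q <= / 400 -> q <= modulus q ^ 2 <= 96 * q.
Proof.
intro hq. destruct (agm_near q hq) as [h1 h2]. assert (h := agm_diff_bounds q hq).
rewrite modulus_sq by lra.
replace (1 - (agm_b q / agm_a q) ^ 2) with ((agm_a q ^ 2 - agm_b q ^ 2) / agm_a q ^ 2) by (field; lra).
assert (9 / 16 <= agm_a q ^ 2 <= 4) by nra.
split; apply (Rmult_le_reg_r (agm_a q ^ 2)); try lra; rewrite Rdiv_mult_cancel by lra; nra.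
Qed.

Lemma ln_bounds (x c d : R) : 0 < c -> c <= x <= d -> Rabs (ln x) <= Rabs (ln c) + Rabs (ln d).
Proof.
intros hc hx. assert (h1 := ln_le c x hc ltac:(lra)). assert (h2 := ln_le x d ltac:(lra) ltac:(lra)).
generalize (Rle_abs (ln d)) (Rabs_pos (ln d)) (Rle_abs (- ln c)) (Rabs_pos (ln c)).
rewrite Rabs_Ropp. intros. apply Rabs_le; lra.
Qed.

Lemma ln_sq (x : R) : 0 < x -> ln (x ^ 2) = 2 * ln x.
Proof. intro h. simpl. rewrite Rmult_1_r, ln_mult by assumption. ring. Qed.

(** Both K'/K and - ln q double under q -> q^2. Their discrepancy is bounded near 0 since (2/PI) ln
    k = ln (k^2) / PI and k^2 / q stays between 1 and 96. *)
Lemma period_ratio_modulus (q : R) : 0 < q < 1 -> period_ratio (modulus q) = - ln q / PI.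
Proof.
intro hq. assert (hpi := PI_RGT_0).
enough (period_ratio (modulus q) + ln q / PI = 0) by (unfold Rdiv in *; lra).
revert q hq. destruct period_ratio_log_bound as [C hC].
apply (doubling_vanish (fun q => period_ratio (modulus q) + ln q / PI) (/ 400)
  (C + (Rabs (ln 1) + Rabs (ln 96)) / PI)); [lra| |].
- intros q hq. assert (hm := modulus_01 q ltac:(lra)). assert (hb := modulus_sq_bounds q hq).
  (* The radius 1/400 gives modulus^2 <= 96/400 < 1/4, so the modulus is within the range of the
     logarithmic bound. *)
  assert (hC' := hC (modulus q) ltac:(nra)).
  replace (period_ratio (modulus q) + ln q / PI)
    with ((period_ratio (modulus q) + 2 / PI * ln (modulus q)) + - (ln (modulus q ^ 2 / q) / PI)).
  + eapply Rle_trans; [apply Rabs_triang|]. apply Rplus_le_compat; [exact hC'|].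
    rewrite Rabs_Ropp, Rabs_div, (Rabs_pos_eq PI) by lra.
    apply Rmult_le_compat_r; [apply Rlt_le, Rinv_0_lt_compat; lra|].
    apply ln_bounds; [lra|]. split; apply (Rmult_le_reg_r q); try lra; rewrite Rdiv_mult_cancel; lra.
  + rewrite ln_div, ln_sq by nra. field; lra.
- intros q hq. rewrite ln_sq by lra. unfold modulus.
  rewrite (period_ratio_landen (agm_a q) (agm_b q)).
  + field; lra.
  + now apply agm_ab_lt.
  + now apply agm_a_sq.
  + now apply agm_b_sq.
Qed.

Lemma eulerP_half (q : R) : 0 < q <= / 400 -> / 2 <= eulerP q <= 3 / 2.
Proof.
intro hq. assert (h := eulerP_near_1 q ltac:(lra)).
assert (q / (1 - q) <= / 2).
{ apply (Rmult_le_reg_r (1 - q)); [lra|]. rewrite Rdiv_mult_cancel by lra. lra. }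
apply Rabs_le_between in h. lra.
Qed.

(* With [V] the quotient of the two sides, the relations between [q] and [q^2] give [V(q)^2 = V(q^2)]. *)
Lemma eulerP_24 (q : R) : 0 < q < 1 ->
  16 * q * eulerP q ^ 24 = agm_a q ^ 2 * agm_b q ^ 8 * (agm_a q ^ 2 - agm_b q ^ 2).
Proof.
set (V := fun q => agm_a q ^ 2 * agm_b q ^ 8 * (agm_a q ^ 2 - agm_b q ^ 2) / (16 * q * eulerP q ^ 24)).
assert (hpos : forall q, 0 < q < 1 -> 0 < V q).
{ intros x hx. assert (h := agm_ab_lt x hx). assert (hP := eulerP_pos x hx).
  assert (0 < agm_a x ^ 2 - agm_b x ^ 2) by nra.
  apply Rdiv_lt_0_compat; (apply Rmult_lt_0_compat; [apply Rmult_lt_0_compat|]); try apply pow_lt; lra. }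
intro hq. enough (e : ln (V q) = 0).
{ assert (e1 : V q = 1) by (rewrite <- (exp_ln (V q)), e by auto; apply exp_0).
  assert (hP := pow_lt _ 24 (eulerP_pos q hq)).
  rewrite <- (Rmult_1_l (16 * q * eulerP q ^ 24)), <- e1. unfold V. apply Rdiv_mult_cancel. nra. }
revert q hq.
(* c and d bound V below and above for q <= 1/400: a and b lie in [3/4, 5/4], the Euler product in
   [1/2, 3/2], and (a^2 - b^2) / q in [4, 54]. *)
set (c := (3 / 4) ^ 2 * (3 / 4) ^ 8 * 4 / (16 * (3 / 2) ^ 24)).
set (d := (5 / 4) ^ 2 * (5 / 4) ^ 8 * 54 / (16 * (/ 2) ^ 24)).
apply (doubling_vanish (fun q => ln (V q)) (/ 400) (Rabs (ln c) + Rabs (ln d))); [lra| |].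
- intros q hq. destruct (agm_near q hq) as [h1 h2]. assert (h := agm_diff_bounds q hq).
  assert (hP := eulerP_half q hq).
  assert (p1 : (3 / 4) ^ 2 <= agm_a q ^ 2 <= (5 / 4) ^ 2) by (split; apply pow_incr; lra).
  assert (p2 : (3 / 4) ^ 8 <= agm_b q ^ 8 <= (5 / 4) ^ 8) by (split; apply pow_incr; lra).
  assert (p3 : (/ 2) ^ 24 <= eulerP q ^ 24 <= (3 / 2) ^ 24) by (split; apply pow_incr; lra).
  assert (g1 : 0 < (3 / 4) ^ 2) by (apply pow_lt; lra).
  assert (g2 : 0 < (3 / 4) ^ 8) by (apply pow_lt; lra).
  assert (g3 : 0 < (/ 2) ^ 24) by (apply pow_lt; lra).
  assert (g4 : 0 < (3 / 2) ^ 24) by (apply pow_lt; lra).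
  apply ln_bounds.
  + apply Rdiv_lt_0_compat; [|lra]. repeat apply Rmult_lt_0_compat; lra.
  + replace (V q) with (agm_a q ^ 2 * agm_b q ^ 8 * ((agm_a q ^ 2 - agm_b q ^ 2) / q) * / (16 * eulerP q ^ 24))
      by (unfold V; field; lra).
    assert (p4 : 4 <= (agm_a q ^ 2 - agm_b q ^ 2) / q <= 54).
    { split; apply (Rmult_le_reg_r q); try lra; rewrite Rdiv_mult_cancel; lra. }
    assert (p5 : / (16 * (3 / 2) ^ 24) <= / (16 * eulerP q ^ 24) <= / (16 * (/ 2) ^ 24)).
    { split; apply Rinv_le_contravar; lra. }
    assert (p6 : 0 < / (16 * (3 / 2) ^ 24)) by (apply Rinv_0_lt_compat; lra).
    split; (apply Rmult_le_compat; [| | apply Rmult_le_compat; [| | apply Rmult_le_compat |] |]);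
      repeat first [lra | apply Rmult_le_pos].
- intros q hq. rewrite <- ln_sq by auto. f_equal.
  assert (hq2 := sq_01 q hq). assert (hP := eulerP_pos q hq). assert (hP2 := eulerP_pos _ hq2).
  assert (hab := agm_ab_lt q hq).
  (* The twelfth power of [theta4_eulerP], with theta_4^12 = b^6, trades the product at q for the
     one at q^2. *)
  assert (e1 : eulerP q ^ 24 = agm_b q ^ 6 * eulerP (q ^ 2) ^ 12).
  { replace (eulerP q ^ 24) with ((eulerP q ^ 2) ^ 12) by (rewrite <- pow_mult; reflexivity).
    rewrite <- theta4_eulerP by assumption. unfold agm_b. ring. }
  assert (e2 : agm_b (q ^ 2) ^ 2 = agm_a q * agm_b q).
  { rewrite agm_b_sq by assumption. apply pow2_sqrt. nra. }
  unfold V. rewrite e1. replace (agm_b (q ^ 2) ^ 8) with ((agm_b (q ^ 2) ^ 2) ^ 4) by ring.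
  rewrite e2, agm_a_sq by assumption. field. lra.
Qed.

Definition nome (k : R) : R := exp (- PI * period_ratio k).

Lemma nome_01 (k : R) : 0 < k < 1 -> 0 < nome k < 1.
Proof.
intro hk. split; [apply exp_pos|]. rewrite <- exp_0. apply exp_increasing.
generalize PI_RGT_0 (period_ratio_pos k hk). nra.
Qed.

(** Both moduli have the same ratio K'/K, which determines the modulus; this identifies the
    theta-function modulus with the given k. *)
Lemma modulus_nome (k : R) : 0 < k < 1 -> modulus (nome k) = k.
Proof.
intro hk. assert (hq := nome_01 k hk). apply period_ratio_inj; [now apply modulus_01 | exact hk|].
rewrite period_ratio_modulus by assumption. unfold nome. rewrite ln_exp. field.
apply PI_neq0.
Qed.

(** At y = s/2 with s = K'/K the variable e^(- 2 PI y) of the eta product is the nome, and the 24th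
    power of the exponential prefactor is the nome as well. [eulerP_24] then applies with a = 2K/PI
    and b/a = k'. *)
Lemma eta_imag_24 (k : R) : 0 < k < 1 ->
  16 * eta_imag (period_ratio k / 2) ^ 24 = (2 * ellK k / PI) ^ 12 * kcomp k ^ 8 * k ^ 2.
Proof.
intro hk. assert (hq := nome_01 k hk). assert (hm := modulus_nome k hk).
assert (hpi := PI_RGT_0).
assert (hab := agm_ab_lt _ hq).
assert (ha : 2 * ellK k / PI = agm_a (nome k)).
{ rewrite <- hm at 1. rewrite ellK_modulus by assumption. field; lra. }
assert (hb : kcomp k = agm_b (nome k) / agm_a (nome k)).
{ rewrite <- hm at 1. unfold modulus. now apply kcomp_invol, agm_ratio_01. }
assert (hk2 : k ^ 2 = 1 - kcomp k ^ 2) by (rewrite kcomp_sq by assumption; ring).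
assert (he : eta_imag (period_ratio k / 2) ^ 24 = nome k * eulerP (nome k) ^ 24).
{ unfold eta_imag. rewrite Rpow_mult_distr. f_equal.
  - unfold nome.
    assert (hexp : forall x n, exp x ^ n = exp (INR n * x)).
    { intros x n; induction n as [|n IH]; [now rewrite Rmult_0_l, exp_0|].
      rewrite S_INR; simpl. rewrite IH, <- exp_plus. f_equal; ring. }
    rewrite hexp. f_equal. replace (INR 24) with 24 by (simpl; lra). field.
  - unfold eulerP, nome.
    replace (-2 * PI * (period_ratio k / 2)) with (- PI * period_ratio k) by field. reflexivity. }
rewrite he, hk2, ha, hb, <- Rmult_assoc, eulerP_24 by assumption. field. lra.
Qed.

(** * Continuity and convergence of the integral *)

Lemma continuous_uniform_limit (u : nat -> R -> R) (f : R -> R) (e : nat -> R) (x : R) :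
  (forall n, continuous (u n) x) ->
  locally x (fun y => forall n, Rabs (f y - u n y) <= e n) ->
  is_lim_seq e 0 -> continuous f x.
Proof.
intros hu hf he. apply continuity_pt_filterlim, continuity_pt_locally. intro eps.
apply is_lim_seq_spec in he.
assert (h3 : 0 < eps / 3) by (destruct eps; simpl; lra).
destruct (he (mkposreal _ h3)) as [N hN]. specialize (hN N (Nat.le_refl N)). simpl in hN.
rewrite Rminus_0_r in hN. apply Rle_lt_trans with (1 := Rle_abs _) in hN.
assert (hc := hu N). apply continuity_pt_filterlim in hc. rewrite continuity_pt_locally in hc.
specialize (hc (mkposreal _ h3)). simpl in hc.
assert (hx := locally_singleton _ _ hf N).
apply filter_imp with (2 := filter_and _ _ hc hf). intros y [hy1 hy2]. specialize (hy2 N).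
replace (f y - f x) with ((f y - u N y) + (u N y - u N x) + - (f x - u N x)) by ring.
eapply Rle_lt_trans; [apply Rabs_triang|]. rewrite Rabs_Ropp.
assert (h4 := Rabs_triang (f y - u N y) (u N y - u N x)). lra.
Qed.

Lemma locally_interval (a b x : R) : a < x < b -> locally x (fun y => a < y < b).
Proof.
intro h. apply (open_and (fun u => a < u) (fun u => u < b)); [apply open_gt | apply open_lt | exact h].
Qed.

Lemma eulerP_continuous (q : R) : 0 < q < 1 -> continuous eulerP q.
Proof.
(* A midpoint r < 1 above q leaves a neighbourhood of q on which the geometric rate is uniform. *)
intro hq. set (r := (q + 1) / 2).
apply (continuous_uniform_limit (fun n x => qprod x n) eulerP (fun n => r / (1 - r) * r ^ n)).
- intro n. induction n as [|n IH]; [apply continuous_const|].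
  apply (continuous_mult (fun x => qprod x n) (fun x => 1 - x ^ S n)); [exact IH|].
  apply continuous_of_derivable. auto_derive. exact I.
- apply filter_imp with (2 := locally_interval 0 r q ltac:(unfold r; lra)).
  intros y hy n. destruct (qprod_lim y r ltac:(lra) ltac:(unfold r; lra)) as [_ h].
  eapply Rle_trans; [apply h|]. apply Req_le; unfold r; field; lra.
- apply is_lim_seq_geom_scal; unfold r; lra.
Qed.

Lemma cf_tail_ge_1 (q : R) (n j : nat) : 0 < q -> 1 <= cf_tail q n j.
Proof.
intro hq. revert j; induction n as [|n IH]; intro j; simpl; [lra|].
assert (0 <= q ^ j / cf_tail q n (S j)); [|lra].
apply Rlt_le, Rdiv_lt_0_compat; [apply pow_lt, hq|]. specialize (IH (S j)); lra.
Qed.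

(** Each level multiplies the difference of two tails x, y by q^j / (x y), at most r because tails
    are at least 1 and j >= 1. *)
Lemma cf_tail_step (q r : R) (n j : nat) : 0 < q <= r -> r < 1 -> (1 <= j)%nat ->
  Rabs (cf_tail q (S n) j - cf_tail q n j) <= r ^ n.
Proof.
intros hq hr. revert j; induction n as [|n IH]; intros j hj.
- simpl. replace (1 + q ^ j / 1 - 1) with (q ^ j) by field.
  rewrite Rabs_pos_eq by (apply pow_le; lra). apply pow_01; lra.
- change (cf_tail q (S (S n)) j) with (1 + q ^ j / cf_tail q (S n) (S j)).
  change (cf_tail q (S n) j) with (1 + q ^ j / cf_tail q n (S j)).
  assert (h1 := cf_tail_ge_1 q (S n) (S j) ltac:(lra)).
  assert (h2 := cf_tail_ge_1 q n (S j) ltac:(lra)).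
  specialize (IH (S j) ltac:(lia)).
  set (x := cf_tail q (S n) (S j)) in *. set (y := cf_tail q n (S j)) in *.
  replace (1 + q ^ j / x - (1 + q ^ j / y)) with (- (q ^ j * (x - y) * / (x * y))) by (field; lra).
  rewrite Rabs_Ropp, !Rabs_mult.
  assert (hj0 : 0 <= q ^ j) by (apply pow_le; lra).
  assert (hj1 : q ^ j <= q ^ 1) by (apply pow_decr; [lra|exact hj]). rewrite pow_1 in hj1.
  assert (hxy : 1 <= x * y) by nra.
  assert (hi : 0 < / (x * y) <= 1).
  { split; [apply Rinv_0_lt_compat; lra|]. rewrite <- Rinv_1. apply Rinv_le_contravar; lra. }
  rewrite (Rabs_pos_eq (q ^ j)), (Rabs_pos_eq (/ (x * y))) by lra.
  assert (h0 := Rabs_pos (x - y)).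
  simpl. rewrite <- (Rmult_1_r (r * r ^ n)).
  apply Rmult_le_compat; try lra; [apply Rmult_le_pos; lra|]. apply Rmult_le_compat; lra.
Qed.

Definition rrcf (q : R) : R := real (Lim_seq (fun N => cf_tail q N 1)).

Lemma rrcf_lim (q r : R) : 0 < q <= r -> r < 1 ->
  is_lim_seq (fun N => cf_tail q N 1) (rrcf q) /\
  forall n, Rabs (rrcf q - cf_tail q n 1) <= 1 * r ^ n / (1 - r).
Proof.
intros hq hr. apply (geom_cauchy (fun N => cf_tail q N 1)); [lra|].
intro n. rewrite Rmult_1_l. now apply cf_tail_step.
Qed.

Lemma rrcf_ge_1 (q : R) : 0 < q < 1 -> 1 <= rrcf q.
Proof.
intro hq. destruct (rrcf_lim q q ltac:(lra) ltac:(lra)) as [h _].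
refine (is_lim_seq_le _ _ _ _ _ (is_lim_seq_const 1) h). intro n; apply cf_tail_ge_1; lra.
Qed.

Lemma cf_tail_continuous (q : R) (n j : nat) : 0 < q -> continuous (fun x => cf_tail x n j) q.
Proof.
intro hq. revert j; induction n as [|n IH]; intro j; [apply continuous_const|].
apply (continuous_plus (fun _ => 1) (fun x => x ^ j / cf_tail x n (S j))); [apply continuous_const|].
apply (continuous_mult (fun x => x ^ j) (fun x => / cf_tail x n (S j))).
- apply continuous_of_derivable. auto_derive. exact I.
- apply (continuous_comp (fun x => cf_tail x n (S j)) Rinv); [apply IH|].
  apply continuous_of_derivable. auto_derive. generalize (cf_tail_ge_1 q n (S j) hq); lra.
Qed.

Lemma rrcf_continuous (q : R) : 0 < q < 1 -> continuous rrcf q.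
Proof.
intro hq. set (r := (q + 1) / 2).
apply (continuous_uniform_limit (fun n x => cf_tail x n 1) rrcf (fun n => 1 / (1 - r) * r ^ n)).
- intro n. apply cf_tail_continuous; lra.
- apply filter_imp with (2 := locally_interval 0 r q ltac:(unfold r; lra)).
  intros y hy n. destruct (rrcf_lim y r ltac:(lra) ltac:(unfold r; lra)) as [_ h].
  eapply Rle_trans; [apply h|]. apply Req_le; unfold r; field; lra.
- apply is_lim_seq_geom_scal; unfold r; lra.
Qed.

Lemma RR_continuous (q : R) : 0 < q < 1 -> continuous RR q.
Proof.
intro hq. apply (continuous_mult (fun q => Rpower q (1 / 5)) (fun q => / rrcf q)).
- apply continuous_of_derivable. unfold Rpower. auto_derive. lra.
- apply (continuous_comp rrcf Rinv); [now apply rrcf_continuous|].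
  apply continuous_of_derivable. auto_derive. generalize (rrcf_ge_1 q hq); lra.
Qed.

Lemma RR_bounds (q : R) : 0 < q < 1 -> 0 <= RR q <= 1.
Proof.
intro hq. assert (h := rrcf_ge_1 q hq). change (RR q) with (Rpower q (1 / 5) / rrcf q).
assert (h1 : 0 < Rpower q (1 / 5) < 1).
{ split; [apply exp_pos|]. apply Rlt_le_trans with (exp 0); [|rewrite exp_0; lra].
  apply exp_increasing. assert (ln q < 0) by (rewrite <- ln_1; apply ln_increasing; lra). lra. }
split; [apply Rlt_le, Rdiv_lt_0_compat; lra|].
apply (Rmult_le_reg_r (rrcf q)); [lra|]. rewrite Rdiv_mult_cancel; lra.
Qed.

Lemma exp_neg_01 (c t : R) : 0 < c -> 0 < t -> 0 < exp (- c * t) < 1.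
Proof.
intros hc ht. split; [apply exp_pos|]. rewrite <- exp_0. apply exp_increasing. nra.
Qed.

Lemma eta_imag_continuous (y : R) : 0 < y -> continuous eta_imag y.
Proof.
intro hy. assert (hpi := PI_RGT_0).
apply (continuous_mult (fun y => exp (- PI * y / 12)) (fun y => eulerP (exp (- 2 * PI * y)))).
- apply continuous_of_derivable. auto_derive. exact I.
- apply (continuous_comp (fun y => exp (- 2 * PI * y)) eulerP).
  + apply continuous_of_derivable. auto_derive. exact I.
  + apply eulerP_continuous. replace (- 2 * PI * y) with (- (2 * PI) * y) by ring.
    apply exp_neg_01; lra.
Qed.

Lemma eta_imag_bounds (y : R) : 0 < y -> 0 < eta_imag y <= exp (- PI * y / 12).
Proof.
intro hy. assert (hpi := PI_RGT_0).
change (eta_imag y) with (exp (- PI * y / 12) * eulerP (exp (- 2 * PI * y))).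
assert (hq : 0 < exp (- 2 * PI * y) < 1).
{ replace (- 2 * PI * y) with (- (2 * PI) * y) by ring. apply exp_neg_01; lra. }
assert (h1 := eulerP_pos _ hq).
assert (h2 : eulerP (exp (- 2 * PI * y)) <= 1).
{ refine (is_lim_seq_le _ _ _ _ _ (eulerP_lim _ hq) (is_lim_seq_const 1)).
  intro n; now apply qprod_bounds. }
assert (h3 := exp_pos (- PI * y / 12)). split; nra.
Qed.

Definition integrand (G : R -> R) (t : R) : R :=
  (eta_imag (t / 2)) ^ 4 * G (RR (exp (- PI * t))).

Lemma integrand_continuous (G : R -> R) (t : R) : (forall x, continuous G x) -> 0 < t ->
  continuous (integrand G) t.
Proof.
intros hG ht. assert (hpi := PI_RGT_0).
apply (continuous_mult (fun t => eta_imag (t / 2) ^ 4) (fun t => G (RR (exp (- PI * t))))).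
- apply (continuous_comp (fun t => eta_imag (t / 2)) (fun x => x ^ 4)).
  + apply (continuous_comp (fun t => t / 2) eta_imag).
    * apply continuous_of_derivable. auto_derive. exact I.
    * apply eta_imag_continuous; lra.
  + apply continuous_of_derivable. auto_derive. exact I.
- apply (continuous_comp (fun t => RR (exp (- PI * t))) G); [|apply hG].
  apply (continuous_comp (fun t => exp (- PI * t)) RR).
  + apply continuous_of_derivable. auto_derive. exact I.
  + apply RR_continuous, exp_neg_01; lra.
Qed.

(** G enters only through its maximum on [0, 1], which contains the values of [RR]. The exponent is
    4 * (PI/12) * (t/2) = PI t / 6. *)
Lemma integrand_bound (G : R -> R) : (forall x, continuous G x) ->
  exists C, forall t, 0 < t -> Rabs (integrand G t) <= C * exp (- (PI / 6) * t).
Proof.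
intro hG. assert (hpi := PI_RGT_0).
destruct (continuity_ab_maj (fun x => Rabs (G x)) 0 1) as [m [hm _]]; [lra| |].
{ intros x _. apply (continuity_pt_comp G Rabs); [|apply Rcontinuity_abs].
  apply continuity_pt_filterlim, hG. }
exists (Rabs (G m)). intros t ht. unfold integrand. rewrite Rabs_mult, Rmult_comm.
apply Rmult_le_compat; try apply Rabs_pos.
- apply hm, RR_bounds, exp_neg_01; lra.
- assert (h := eta_imag_bounds (t / 2) ltac:(lra)).
  rewrite Rabs_pos_eq by (apply pow_le; lra).
  apply Rle_trans with (exp (- PI * (t / 2) / 12) ^ 4); [apply pow_incr; lra|].
  simpl. rewrite Rmult_1_r, <- !exp_plus. apply Req_le. f_equal. field.
Qed.

Lemma ex_RInt_pos (f : R -> R) (a b : R) : (forall t, 0 < t -> continuous f t) ->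
  0 < a -> 0 < b -> ex_RInt f a b.
Proof.
intros hf ha hb. apply (ex_RInt_continuous (V := R_CompleteNormedModule)).
intros z hz. apply hf. apply Rlt_le_trans with (2 := proj1 hz). now apply Rmin_glb_lt.
Qed.

Lemma exp_decay_tail (c C eps : R) : 0 < c -> 0 < eps ->
  exists M, 1 <= M /\ C * exp (- c * M) < eps.
Proof.
intros hc he.
exists (Rmax 1 (Rabs C / eps / c)). set (M := Rmax _ _).
assert (h1 : 1 <= M) by apply Rmax_l. assert (h2 : Rabs C / eps / c <= M) by apply Rmax_r.
split; [exact h1|].
assert (h3 : Rabs C <= eps * (c * M)).
{ apply (Rmult_le_compat_r (c * eps)) in h2; [|apply Rmult_le_pos; lra].
  replace (Rabs C / eps / c * (c * eps)) with (Rabs C) in h2 by (field; lra). lra. }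
assert (h4 := exp_ineq1 (c * M) ltac:(nra)).
assert (h5 : exp (- c * M) * exp (c * M) = 1).
{ rewrite <- exp_plus, <- exp_0. f_equal; ring. }
assert (h6 := exp_pos (- c * M)).
apply Rle_lt_trans with (Rabs C * exp (- c * M)).
{ apply Rmult_le_compat_r; [lra | apply Rle_abs]. }
apply Rle_lt_trans with (eps * (c * M) * exp (- c * M)); [apply Rmult_le_compat_r; lra|].
assert (c * M * exp (- c * M) < 1) by nra. nra.
Qed.

(** One constant L, the integral from 1 to infinity, serves every lower limit x; this reduces
    differentiation in x to a proper integral. *)
Lemma is_RInt_gen_exp_decay (f : R -> R) (c C : R) : 0 < c ->
  (forall t, 0 < t -> continuous f t) ->
  (forall t, 0 < t -> Rabs (f t) <= C * exp (- c * t)) ->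
  exists L, forall x, 0 < x ->
    is_RInt_gen f (at_point x) (Rbar_locally p_infty) (L - RInt f 1 x).
Proof.
intros hc hf hb.
assert (hC : 0 <= C).
{ generalize (hb 1 Rlt_0_1) (Rabs_pos (f 1)) (exp_pos (- c * 1)). nra. }
assert (hd : forall u v, 1 <= u -> u <= v -> Rabs (RInt f 1 v - RInt f 1 u) <= C / c * exp (- c * u)).
{ intros u v hu hv.
  replace (RInt f 1 v - RInt f 1 u) with (RInt f u v).
  2:{ assert (e := RInt_Chasles (V := R_CompleteNormedModule) f 1 u v
        (ex_RInt_pos f 1 u hf ltac:(lra) ltac:(lra)) (ex_RInt_pos f u v hf ltac:(lra) ltac:(lra))).
      change (RInt f 1 u + RInt f u v = RInt f 1 v) in e. lra. }
  apply Rle_trans with (- C / c * exp (- c * v) - - C / c * exp (- c * u)).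
  - apply (norm_RInt_le f (fun t => C * exp (- c * t)) u v); [exact hv| | |].
    + intros t ht. apply hb; lra.
    + apply (RInt_correct (V := R_CompleteNormedModule)), ex_RInt_pos; try lra. exact hf.
    + apply (is_RInt_derive (fun t => - C / c * exp (- c * t))).
      * intros t _. auto_derive; [exact I | field; lra].
      * intros t _. apply continuous_of_derivable. auto_derive. exact I.
  - assert (0 <= C / c * exp (- c * v)).
    { apply Rmult_le_pos; [apply Rdiv_le_0_compat; lra | apply Rlt_le, exp_pos]. }
    unfold Rdiv in *. lra. }
assert (hlim : exists L, filterlim (fun b => RInt f 1 b) (Rbar_locally p_infty) (locally L)).
{ apply (filterlim_locally_cauchy (F := Rbar_locally p_infty) (U := R_CompleteNormedModule) (fun b => RInt f 1 b)).
  intros [eps heps]. destruct (exp_decay_tail c (C / c) (eps / 2) hc ltac:(lra)) as [M [hM1 hM2]].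
  exists (fun u => M < u). split; [exists M; auto|]. intros u v hu hv.
  change (Rabs (RInt f 1 v - RInt f 1 u) < eps).
  assert (h1 := hd M u hM1 ltac:(lra)). assert (h2 := hd M v hM1 ltac:(lra)).
  replace (RInt f 1 v - RInt f 1 u) with ((RInt f 1 v - RInt f 1 M) + - (RInt f 1 u - RInt f 1 M)) by ring.
  eapply Rle_lt_trans; [apply Rabs_triang|]. rewrite Rabs_Ropp. lra. }
destruct hlim as [L hL]. exists L. intros x hx P hP.
assert (hL' : filterlim (fun b => RInt f 1 b - RInt f 1 x) (Rbar_locally p_infty) (locally (L - RInt f 1 x))).
{ apply (filterlim_comp _ _ _ (fun b => RInt f 1 b) (fun y => y - RInt f 1 x) _ (locally L)); [exact hL|].
  apply (continuous_minus (fun y : R => y) (fun _ => RInt f 1 x) L);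
    [apply continuous_id | apply continuous_const]. }
specialize (hL' P hP). unfold filtermapi.
(* Restricting to b > 0 keeps the interval between x and b inside the half-line where f is
   continuous. *)
apply (Filter_prod _ _ _ (fun a => a = x) (fun b => 0 < b /\ P (RInt f 1 b - RInt f 1 x))).
- reflexivity.
- apply filter_and; [exists 0; auto | exact hL'].
- intros a b -> [hb0 hbP]. exists (RInt f 1 b - RInt f 1 x). split; [|exact hbP]. simpl.
  replace (RInt f 1 b - RInt f 1 x) with (RInt f x b).
  + apply (RInt_correct (V := R_CompleteNormedModule)), ex_RInt_pos; assumption.
  + assert (e := RInt_Chasles (V := R_CompleteNormedModule) f 1 x b
        (ex_RInt_pos f 1 x hf ltac:(lra) ltac:(lra)) (ex_RInt_pos f x b hf ltac:(lra) ltac:(lra))).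
    change (RInt f 1 x + RInt f x b = RInt f 1 b) in e. lra.
Qed.

(** * Sixth powers and the final derivative *)

Lemma pow_6_inj (x y : R) : 0 < x -> 0 < y -> x ^ 6 = y ^ 6 -> x = y.
Proof.
intros hx hy e.
assert (e1 : (x - y) * (x ^ 5 + x ^ 4 * y + x ^ 3 * y ^ 2 + x ^ 2 * y ^ 3 + x * y ^ 4 + y ^ 5) = 0)
  by (ring_simplify; lra).
apply Rmult_integral in e1. destruct e1 as [e1|e1]; [lra|exfalso].
assert (0 < x ^ 5 + x ^ 4 * y + x ^ 3 * y ^ 2 + x ^ 2 * y ^ 3 + x * y ^ 4 + y ^ 5); [|lra].
repeat first [apply pow_lt; assumption | assumption | apply Rplus_lt_0_compat | apply Rmult_lt_0_compat].
Qed.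

Lemma Rpower_pow_mul (x a : R) (n m : nat) : 0 < x -> a * INR n = INR m -> Rpower x a ^ n = x ^ m.
Proof.
intros hx h. rewrite <- (Rpower_pow n) by apply exp_pos. rewrite Rpower_mult, h.
now apply Rpower_pow.
Qed.

(** The sixth power turns eta^4 into eta^24 and the right side into 2^2 / (k k')^4. After
    [eta_imag_24] the powers of PI and K cancel, and the numerical factor is 2^12 / (16 * 2^6) =
    4. *)
Lemma eta_imag_modulus (k : R) : 0 < k < 1 ->
  PI * (eta_imag (period_ratio k / 2) ^ 4 * (PI / (2 * k * (1 - k ^ 2) * ellK k ^ 2))) =
  Rpower 2 (1 / 3) / Rpower (k * kcomp k) (2 / 3).
Proof.
intro hk. assert (hpi := PI_RGT_0). assert (hq := kcomp_bounds k hk).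
assert (hK := ellK_pos k hk). assert (hs := period_ratio_pos k hk).
assert (he := proj1 (eta_imag_bounds (period_ratio k / 2) ltac:(lra))).
assert (h24 := eta_imag_24 k hk). assert (h2 := kcomp_sq k hk).
assert (hkk : 0 < k * kcomp k) by (apply Rmult_lt_0_compat; lra).
assert (hR : 0 < Rpower (k * kcomp k) (2 / 3)) by apply exp_pos.
assert (hR2 : 0 < Rpower 2 (1 / 3)) by apply exp_pos.
assert (hden : 0 < 2 * k * kcomp k ^ 2 * ellK k ^ 2).
{ repeat apply Rmult_lt_0_compat; try apply pow_lt; lra. }
rewrite <- h2. set (e := eta_imag (period_ratio k / 2)) in *.
apply pow_6_inj.
- apply Rmult_lt_0_compat; [lra|]. apply Rmult_lt_0_compat; [apply pow_lt, he | apply Rdiv_lt_0_compat; lra].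
- apply Rdiv_lt_0_compat; assumption.
- replace ((Rpower 2 (1 / 3) / Rpower (k * kcomp k) (2 / 3)) ^ 6)
    with (Rpower 2 (1 / 3) ^ 6 / Rpower (k * kcomp k) (2 / 3) ^ 6) by (field; lra).
  rewrite (Rpower_pow_mul 2 (1 / 3) 6 2), (Rpower_pow_mul (k * kcomp k) (2 / 3) 6 4)
    by (try assumption; simpl; lra).
  transitivity (PI ^ 12 * (16 * e ^ 24) / (16 * (2 * k * kcomp k ^ 2 * ellK k ^ 2) ^ 6)); [field; lra|].
  rewrite h24. field. repeat split; lra.
Qed.

Theorem theorem2 (G : R -> R) (HG : smooth G) (k : R) (hk : 0 < k < 1) :
  is_derive (A_of_k G) k
    (Rpower 2 (1 / 3) * G (RR (exp (- PI * sqrt (sing_param k))))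
       / Rpower (k * kcomp k) (2 / 3)).
Proof.
assert (hG : forall x, continuous G x) by (intro x; apply continuous_of_derivable, (HG 1%nat x)).
assert (hf := fun t => integrand_continuous G t hG).
destruct (integrand_bound G hG) as [C hC].
destruct (is_RInt_gen_exp_decay (integrand G) (PI / 6) C) as [L hL];
  [generalize PI_RGT_0; lra | exact hf | exact hC |].
assert (hsqrt : forall x, 0 < x < 1 -> sqrt (sing_param x) = period_ratio x).
{ intros x hx. apply sqrt_pow2, Rlt_le, period_ratio_pos, hx. }
assert (hs := period_ratio_pos k hk).
set (F := fun b => RInt (integrand G) 1 b).
apply (is_derive_ext_loc (fun x => PI * (L - F (period_ratio x)))).
(* The closed form of [A_of_k] holds for moduli in (0, 1), a neighbourhood of k, which suffices for
   the derivative. *)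
- apply filter_imp with (2 := locally_interval 0 1 k hk). intros x hx.
  unfold A_of_k, A_of_m. rewrite hsqrt by assumption. f_equal. symmetry.
  apply is_RInt_gen_unique. apply hL, period_ratio_pos, hx.
- assert (hF : is_derive F (period_ratio k) (integrand G (period_ratio k))).
  { apply (is_derive_RInt (integrand G) F 1).
    - apply filter_imp with (2 := locally_interval 0 (period_ratio k + 1) (period_ratio k) ltac:(lra)).
      intros b hb. apply (RInt_correct (V := R_CompleteNormedModule)), ex_RInt_pos; try lra. exact hf.
    - now apply hf. }
  assert (d := is_derive_scal _ _ PI _ (is_derive_minus _ _ _ _ _ (is_derive_const L k)
     (is_derive_comp F period_ratio k _ _ hF (period_ratio_derive k hk)))).
  match type of d with is_derive _ _ ?l => match goal with |- is_derive _ _ ?r =>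
    replace r with l; [exact d|] end end.
  rewrite hsqrt by assumption.
  (* The minus sign from the moving lower limit cancels the one in the derivative of the decreasing
     function K'/K. *)
  transitivity (PI * (eta_imag (period_ratio k / 2) ^ 4 * (PI / (2 * k * (1 - k ^ 2) * ellK k ^ 2)))
     * G (RR (exp (- PI * period_ratio k)))).
  + match goal with |- _ = ?r =>
      change (PI * (0 - (- PI / (2 * k * (1 - k ^ 2) * ellK k ^ 2) *
        (eta_imag (period_ratio k / 2) ^ 4 * G (RR (exp (- PI * period_ratio k)))))) = r) end.
    unfold Rdiv; ring.
  + rewrite eta_imag_modulus by assumption. unfold Rdiv; ring.
Qed.
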